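(* Let $(A,d,\{,\})$ be a differential graded Poisson algebra over a field $\Bbbk$, and let $(A^e,\partial)$ be the differential graded algebra with linear maps $m,h:A\to A^e$, $m(a)=m_a$, $h(a)=h_a$, constructed in the context. Then: (1) There is an isomorphism of categories $\mathbf{DGP}(A)\cong\mathbf{DG}(A^e)$, where $\mathbf{DGP}(A)$ is the category of left differential graded Poisson modules over $A$ and $\mathbf{DG}(A^e)$ is the category of left differential graded modules over $A^e$. (2) The differential graded algebra $A^e$ is the universal enveloping algebra of $A$. That is, $(A^e,\partial)$ together with the differential graded algebra map $m:(A,d)\to(A^e,\partial)$ and the differential graded Lie algebra map $h:(A,\{,\},d)\to(A^e,[,],\partial)$ (which satisfy $m(\{a,b\})=h(a)m(b)-(-1)^{|a||b|}m(b)h(a)$ and $h(ab)=m(a)h(b)+(-1)^{|a||b|}m(b)h(a)$ for homogeneous $a,b\in A$) has the following property: for any differential graded algebra $(D,\delta)$ with a differential graded algebra map $f:(A,d)\to(D,\delta)$ and a differential graded Lie algebra map $g:(A,\{,\},d)\to(D,[,],\delta)$ satisfying $$f(\{a,b\})=g(a)f(b)-(-1)^{|a||b|}f(b)g(a),\qquad g(ab)=f(a)g(b)+(-1)^{|a||b|}f(b)g(a)$$ for all homogeneous $a,b\in A$, there exists a unique differential graded algebra map $\phi:(A^e,\partial)\to(D,\delta)$ such that $\phi m=f$ and $\phi h=g$.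
   Context: Everything is over a field $\Bbbk$; all algebras have an identity, maps of algebras preserve it, modules are unitary; gradings are by $\mathbb{Z}$ and $|x|$ is the degree of a homogeneous element $x$. A differential graded (DG) algebra is a graded algebra with a linear map $d$ of degree $1$ with $d^2=0$ and $d(ab)=d(a)b+(-1)^{|a|}a\,d(b)$ for homogeneous $a,b$. DG algebra maps are graded algebra maps of degree $0$ commuting with differentials. A DG Lie algebra $(L,\{,\},d)$ is a graded vector space with a degree $0$ bracket satisfying $\{a,b\}=-(-1)^{|a||b|}\{b,a\}$ and $\{a,\{b,c\}\}=\{\{a,b\},c\}+(-1)^{|a||b|}\{b,\{a,c\}\}$, and a degree $1$ linear map $d$ with $d^2=0$, $d(\{a,b\})=\{d(a),b\}+(-1)^{|a|}\{a,d(b)\}$. DG Lie algebra maps are degree $0$ linear maps commuting with brackets and differentials. A DG algebra $(D,\delta)$ is regarded as a DG Lie algebra via $[x,y]=xy-(-1)^{|x||y|}yx$. A DG Poisson algebra $(A,\cdot,\{,\},d)$ is a DG algebra $(A,\cdot,d)$ that is graded commutative, $ab=(-1)^{|a||b|}ba$, such that $(A,\{,\},d)$ is a DG Lie algebra and $\{a,bc\}=\{a,b\}c+(-1)^{|a||b|}b\{a,c\}$ for homogeneous $a,b,c$. A left DG module over a DG algebra $(R,d)$ is a graded left $R$-module $M$ with a linear map $\partial$ of degree $1$ with $\partial^2=0$ and $\partial(rx)=d(r)x+(-1)^{|r|}r\partial(x)$; morphisms are degree $0$ graded module maps commuting with differentials. A left DG Poisson module over a DG Poisson algebra $A$ is a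 left DG $A$-module $(M,\partial)$ with a degree $0$ linear map $\{,\}_M:A\otimes M\to M$ such that for homogeneous $a,b\in A$, $x\in M$: $\{a,bx\}_M=\{a,b\}x+(-1)^{|a||b|}b\{a,x\}_M$; $\{ab,x\}_M=a\{b,x\}_M+(-1)^{|a||b|}b\{a,x\}_M$; $\{a,\{b,x\}_M\}_M=\{\{a,b\},x\}_M+(-1)^{|a||b|}\{b,\{a,x\}_M\}_M$; $\partial(\{a,x\}_M)=\{d(a),x\}_M+(-1)^{|a|}\{a,\partial(x)\}_M$. Morphisms are degree $0$ graded $A$-module maps commuting with the differentials and satisfying $f(\{a,x\}_M)=\{a,f(x)\}_N$. Construction of $A^e$: let $m_A=\{m_a\mid a\in A\}$ and $h_A=\{h_a\mid a\in A\}$ be two copies of the graded vector space $A$ (via linear isomorphisms $a\mapsto m_a$, $a\mapsto h_a$), with $|m_a|=|h_a|=|a|$. $A^e$ is the graded algebra generated by $m_A$ and $h_A$ subject to, for all homogeneous $a,b\in A$: $m_{ab}=m_am_b$; $h_{ab}=m_ah_b+(-1)^{|a||b|}m_bh_a$; $m_{\{a,b\}}=h_am_b-(-1)^{|a||b|}m_bh_a$; $h_{\{a,b\}}=h_ah_b-(-1)^{|a||b|}h_bh_a$; $m_1=1$. Its differential $\partial$ is the degree $1$ map determined by $\partial(m_a)=m_{d(a)}$, $\partial(h_a)=h_{d(a)}$ and $\partial(xy)=\partial(x)y+(-1)^{|x|}x\partial(y)$. *)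

(* Defs.v *)
From HB Require Import structures.
From mathcomp Require Import all_boot all_order all_algebra.
From mathcomp Require Import boolp.

Set Implicit Arguments.
Unset Strict Implicit.
Unset Printing Implicit Defensive.

Import GRing.Theory.
Local Open Scope ring_scope.

(* [algType] requires [1 != 0]; here the zero algebra is allowed. *)
Record pzAlgType (k : pzRingType) := PzAlgType {
  pza_ring : pzRingType;
  pza_lmod : GRing.Zmodule_isLmodule k pza_ring;
  pza_scaleAl : forall c (x y : pza_ring),
    GRing.Zmodule_isLmodule.scale pza_lmod c (x * y)
      = GRing.Zmodule_isLmodule.scale pza_lmod c x * y;
  pza_scaleAr : forall c (x y : pza_ring),
    GRing.Zmodule_isLmodule.scale pza_lmod c (x * y)
      = x * GRing.Zmodule_isLmodule.scale pza_lmod c y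
}.
Definition pza_sort (k : pzRingType) (A : pzAlgType k) : Type := pza_ring A.
Coercion pza_sort : pzAlgType >-> Sortclass.
HB.instance Definition _ (k : pzRingType) (A : pzAlgType k) :=
  GRing.PzRing.copy (pza_sort A) (pza_ring A).
HB.instance Definition _ (k : pzRingType) (A : pzAlgType k) :
  GRing.Zmodule_isLmodule k (pza_sort A) := pza_lmod A.
Lemma pzscalerAl (k : pzRingType) (A : pzAlgType k) c (x y : A) :
  c *: (x * y) = (c *: x) * y.
Proof. exact: pza_scaleAl. Qed.

Lemma pzscalerAr (k : pzRingType) (A : pzAlgType k) c (x y : A) :
  c *: (x * y) = x * (c *: y).
Proof. exact: pza_scaleAr. Qed.

Definition bilin (k : pzRingType) (U V W : lmodType k) (f : U -> V -> W) : Prop :=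
  (forall x, linear (f x)) /\ (forall y, linear (f^~ y)).

(* An internal Z-grading: [V] is the direct sum of the subspaces [hpart i]. *)
Record grading (k : fieldType) (V : lmodType k) := Grading {
  hpart :> int -> V -> Prop;
  hpart0 : forall i, hpart i 0;
  hpartP : forall i (c : k) x y,
    hpart i x -> hpart i y -> hpart i (c *: x + y);
  hpart_span : forall x, exists (s : seq int) (f : int -> V),
    (forall i, hpart i (f i)) /\ x = \sum_(i <- s) f i;
  hpart_free : forall (s : seq int) (f : int -> V), uniq s ->
    (forall i, hpart i (f i)) -> \sum_(i <- s) f i = 0 ->
    forall i, i \in s -> f i = 0
}.

(* In the axioms below, signs only involve the degrees of some of the
   variables; the remaining variables range over all elements, which by
   linearity is the same as ranging over homogeneous ones. *)

Record dgVect (k : fieldType) := DGVect {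
  dgv_car :> lmodType k;
  dgv_gr : grading dgv_car;
  dgv_d : {linear dgv_car -> dgv_car};
  dgv_d_deg : forall i x, dgv_gr i x -> dgv_gr (i + 1) (dgv_d x);
  dgv_dd : forall x, dgv_d (dgv_d x) = 0
}.

Definition homog (k : fieldType) (V : dgVect k) (i : int) (x : V) : Prop :=
  dgv_gr V i x.

Definition dgd (k : fieldType) (V : dgVect k) (x : V) : V := dgv_d V x.

Arguments homog {k} V i x.
Arguments dgd {k} V x.

Definition dg_linear (k : fieldType) (V W : dgVect k) (f : V -> W) : Prop :=
  [/\ linear f,
      forall i x, homog V i x -> homog W i (f x)
    & forall x, f (dgd V x) = dgd W (f x)].

Record dgAlg (k : fieldType) := DGAlg {
  dga_car :> pzAlgType k;
  dga_gr : grading dga_car;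
  dga_d : {linear dga_car -> dga_car};
  dga_d_deg : forall i x, dga_gr i x -> dga_gr (i + 1) (dga_d x);
  dga_dd : forall x, dga_d (dga_d x) = 0;
  dga_deg1 : dga_gr 0 1;
  dga_degM : forall i j x y,
    dga_gr i x -> dga_gr j y -> dga_gr (i + j) (x * y);
  dga_dM : forall i x y, dga_gr i x ->
    dga_d (x * y) = dga_d x * y + (-1) ^ i *: (x * dga_d y)
}.

Definition dga_vect (k : fieldType) (D : dgAlg k) : dgVect k :=
  DGVect (@dga_d_deg k D) (@dga_dd k D).

Coercion dga_vect : dgAlg >-> dgVect.

Definition is_dgAlgHom (k : fieldType) (D E : dgAlg k) (f : D -> E) : Prop :=
  [/\ @dg_linear k D E f, f 1 = 1 & forall x y, f (x * y) = f x * f y].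

Record isDGLie (k : fieldType) (L : dgVect k) (br : L -> L -> L) : Prop :=
  IsDGLie {
  dgl_bilin : bilin br;
  dgl_deg : forall i j a b,
    homog L i a -> homog L j b -> homog L (i + j) (br a b);
  dgl_anti : forall i j a b, homog L i a -> homog L j b ->
    br a b = - ((-1) ^ (i * j) *: br b a);
  dgl_jacobi : forall i j a b c, homog L i a -> homog L j b ->
    br a (br b c) = br (br a b) c + (-1) ^ (i * j) *: br b (br a c);
  dgl_d : forall i a b, homog L i a ->
    dgd L (br a b) = br (dgd L a) b + (-1) ^ i *: br a (dgd L b)
}.

Record dgLie (k : fieldType) := DGLie {
  dgl_vect :> dgVect k;
  dgl_br : dgl_vect -> dgl_vect -> dgl_vect;
  dgl_ax : isDGLie dgl_br
}.

Definition is_dgLieHom (k : fieldType) (L M : dgLie k) (f : L -> M) : Prop :=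
  dg_linear f /\ forall x y, f (dgl_br x y) = dgl_br (f x) (f y).

Record dgPoisson (k : fieldType) := DGPoisson {
  dgp_alg :> dgAlg k;
  pbr : dgp_alg -> dgp_alg -> dgp_alg;
  pbr_lie : @isDGLie k dgp_alg pbr;
  pmulC : forall i j (a b : dgp_alg), homog dgp_alg i a -> homog dgp_alg j b ->
    a * b = (-1) ^ (i * j) *: (b * a);
  pbrM : forall i j (a b c : dgp_alg), homog dgp_alg i a -> homog dgp_alg j b ->
    pbr a (b * c) = pbr a b * c + (-1) ^ (i * j) *: (b * pbr a c)
}.

Definition dgLie_of_dgPoisson (k : fieldType) (A : dgPoisson k) : dgLie k :=
  DGLie (pbr_lie A).

Record category := Category {
  cob :> Type;
  chom : cob -> cob -> Type;
  cid1 : forall X, chom X X;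
  ccomp : forall X Y Z, chom Y Z -> chom X Y -> chom X Z;
  ccompA : forall X Y Z T (h : chom Z T) (g : chom Y Z) (f : chom X Y),
    ccomp h (ccomp g f) = ccomp (ccomp h g) f;
  ccomp1l : forall X Y (f : chom X Y), ccomp (cid1 Y) f = f;
  ccomp1r : forall X Y (f : chom X Y), ccomp f (cid1 X) = f
}.

Record functor (C D : category) := Functor {
  fob :> C -> D;
  fhom : forall X Y : C, chom X Y -> chom (fob X) (fob Y);
  fhom1 : forall X, fhom (cid1 X) = cid1 (fob X);
  fhomM : forall X Y Z (g : chom Y Z) (f : chom X Y),
    fhom (ccomp g f) = ccomp (fhom g) (fhom f)
}.

Definition functor_id (C : category) : functor C C :=
  @Functor C C id (fun _ _ => id) (fun _ => erefl) (fun _ _ _ _ _ => erefl).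

Section FunctorComp.
Variables (C D E : category) (G : functor D E) (F : functor C D).
Let h (X Y : C) (f : chom X Y) := fhom G (fhom F f).
Fact functor_comp_id X : h (cid1 X) = cid1 (G (F X)).
Proof. by rewrite /h !fhom1. Qed.
Fact functor_comp_comp X Y Z (g : chom Y Z) (f : chom X Y) :
  h (ccomp g f) = ccomp (h g) (h f).
Proof. by rewrite /h !fhomM. Qed.
Definition functor_comp : functor C E :=
  Functor functor_comp_id functor_comp_comp.
End FunctorComp.

(* Isomorphism, not equivalence: the composites are equal to the identities. *)
Definition isomorphic_categories (C D : category) : Prop :=
  exists (F : functor C D) (G : functor D C),
    functor_comp G F = functor_id C /\ functor_comp F G = functor_id D.

Section Modules.
Variable k : fieldType.

(* The action of [R] is a record field, rather than an [lmodType R] structure, so that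
   restriction and extension of actions fix the underlying complex. *)
Record dgMod (R : dgAlg k) := DGMod {
  dgm_vect :> dgVect k;
  act : R -> dgm_vect -> dgm_vect;
  act_bilin : bilin act;
  act1 : forall x, act 1 x = x;
  actM : forall r s x, act (r * s) x = act r (act s x);
  act_deg : forall i j r x, homog R i r -> homog dgm_vect j x ->
    homog dgm_vect (i + j) (act r x);
  act_d : forall i r x, homog R i r ->
    dgd dgm_vect (act r x)
      = act (dgd R r) x + (-1) ^ i *: act r (dgd dgm_vect x)
}.

Record dgModHom (R : dgAlg k) (M N : dgMod R) := DGModHom {
  dgmh_fun :> M -> N;
  dgmh_dg : dg_linear dgmh_fun;
  dgmh_act : forall r x, dgmh_fun (act r x) = act r (dgmh_fun x)
}.

Record dgPMod (A : dgPoisson k) := DGPMod {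
  dgpm_mod :> dgMod A;
  pact : A -> dgpm_mod -> dgpm_mod;
  pact_bilin : bilin pact;
  pact_deg : forall i j a x, homog A i a -> homog dgpm_mod j x ->
    homog dgpm_mod (i + j) (pact a x);
  pact_act : forall i j a b x, homog A i a -> homog A j b ->
    pact a (act b x) = act (pbr a b) x + (-1) ^ (i * j) *: act b (pact a x);
  pactM : forall i j a b x, homog A i a -> homog A j b ->
    pact (a * b) x = act a (pact b x) + (-1) ^ (i * j) *: act b (pact a x);
  pact_br : forall i j a b x, homog A i a -> homog A j b ->
    pact a (pact b x)
      = pact (pbr a b) x + (-1) ^ (i * j) *: pact b (pact a x);
  pact_d : forall i a x, homog A i a ->
    dgd dgpm_mod (pact a x)
      = pact (dgd A a) x + (-1) ^ i *: pact a (dgd dgpm_mod x)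
}.

Record dgPModHom (A : dgPoisson k) (M N : dgPMod A) := DGPModHom {
  dgpmh_fun :> dgModHom M N;
  dgpmh_pact : forall a x, dgpmh_fun (pact a x) = pact a (dgpmh_fun x)
}.

Lemma dg_linear_id (V : dgVect k) : dg_linear (fun x : V => x).
Proof. by split. Qed.

Lemma dg_linear_comp (U V W : dgVect k) (g : V -> W) (f : U -> V) :
  dg_linear g -> dg_linear f -> dg_linear (fun x => g (f x)).
Proof.
move=> [gl gh gd] [fl fh fd]; split.
- by move=> c x y; rewrite fl gl.
- by move=> i x /fh /gh.
- by move=> x; rewrite fd gd.
Qed.

Lemma dgModHom_eq (R : dgAlg k) (M N : dgMod R) (f g : dgModHom M N) :
  f =1 g -> f = g.
Proof.
case: f g => [f f1 f2] [g g1 g2] /= /funext efg; case: _ / efg in g1 g2 *.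
by congr DGModHom.
Qed.

Lemma dgPModHom_eq (A : dgPoisson k) (M N : dgPMod A) (f g : dgPModHom M N) :
  f =1 g -> f = g.
Proof.
case: f g => [f f1] [g g1] /= /dgModHom_eq efg; case: _ / efg in g1 *.
by congr DGPModHom.
Qed.

Definition dgModHom_id (R : dgAlg k) (M : dgMod R) : dgModHom M M :=
  @DGModHom R M M (fun x => x) (@dg_linear_id M) (fun _ _ => erefl).

Fact dgModHom_comp_subproof (R : dgAlg k) (M N P : dgMod R)
    (g : dgModHom N P) (f : dgModHom M N) r x : g (f (act r x)) = act r (g (f x)).
Proof. by rewrite !dgmh_act. Qed.

Definition dgModHom_comp (R : dgAlg k) (M N P : dgMod R)
    (g : dgModHom N P) (f : dgModHom M N) : dgModHom M P :=
  DGModHom (dg_linear_comp (dgmh_dg g) (dgmh_dg f)) (dgModHom_comp_subproof g f).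

Definition dgPModHom_id (A : dgPoisson k) (M : dgPMod A) : dgPModHom M M :=
  @DGPModHom A M M (dgModHom_id M) (fun _ _ => erefl).

Fact dgPModHom_comp_subproof (A : dgPoisson k) (M N P : dgPMod A)
    (g : dgPModHom N P) (f : dgPModHom M N) a x :
  dgModHom_comp g f (pact a x) = pact a (dgModHom_comp g f x).
Proof. by rewrite /= !dgpmh_pact. Qed.

Definition dgPModHom_comp (A : dgPoisson k) (M N P : dgPMod A)
    (g : dgPModHom N P) (f : dgPModHom M N) : dgPModHom M P :=
  DGPModHom (dgPModHom_comp_subproof g f).

Definition DGMod_cat (R : dgAlg k) : category.
Proof.
refine (@Category (dgMod R) (@dgModHom R) (@dgModHom_id R)
  (@dgModHom_comp R) _ _ _) => *; exact: dgModHom_eq.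
Defined.

Definition DGPMod_cat (A : dgPoisson k) : category.
Proof.
refine (@Category (dgPMod A) (@dgPModHom A) (@dgPModHom_id A)
  (@dgPModHom_comp A) _ _ _) => *; exact: dgPModHom_eq.
Defined.

End Modules.
Section LinearPred.
Variables (k : pzRingType) (U V : lmodType k) (f : U -> V).
Hypothesis fl : linear f.

Lemma linD x y : f (x + y) = f x + f y.
Proof. by rewrite -[x]scale1r fl !scale1r. Qed.

Lemma lin0 : f 0 = 0.
Proof. by apply: (addrI (f 0)); rewrite -linD !addr0. Qed.

Lemma linZ c x : f (c *: x) = c *: f x.
Proof. by rewrite -[c *: x]addr0 fl lin0 addr0. Qed.

Lemma lin_sum (I : Type) (s : seq I) (F : I -> U) :
  f (\sum_(i <- s) F i) = \sum_(i <- s) f (F i).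
Proof. exact: (big_morph f linD lin0). Qed.

End LinearPred.

Section GradingTheory.
Variables (k : fieldType) (V : lmodType k) (G : grading V).

Lemma hpartD i x y : G i x -> G i y -> G i (x + y).
Proof. by move=> hx hy; rewrite -[x]scale1r; apply: hpartP. Qed.

Lemma hpartZ i c x : G i x -> G i (c *: x).
Proof. by move=> hx; rewrite -[_ *: _]addr0; apply: hpartP => //; apply: hpart0. Qed.

Lemma hpartB i x y : G i x -> G i y -> G i (x - y).
Proof. by move=> hx hy; rewrite -scaleN1r; apply: hpartD => //; apply: hpartZ. Qed.

Lemma hpart_sum i (I : Type) (s : seq I) (F : I -> V) :
  (forall j, G i (F j)) -> G i (\sum_(j <- s) F j).
Proof.
move=> hF; apply: big_ind; [exact: hpart0 | exact: hpartD | by []].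
Qed.

Lemma big_supp (W : zmodType) (s u : seq int) (F : int -> W) :
  uniq s -> uniq u -> {subset s <= u} -> (forall i, i \notin s -> F i = 0) ->
  \sum_(i <- u) F i = \sum_(i <- s) F i.
Proof.
move=> us uu su F0; rewrite (bigID (mem s)) /= [X in _ + X]big1 ?addr0 //.
rewrite -big_filter; apply: perm_big; apply: uniq_perm => //.
  exact: filter_uniq.
by move=> i; rewrite mem_filter; apply: andb_idr; apply: su.
Qed.

Lemma hdecomp x : exists p : seq int * (int -> V),
  [/\ uniq p.1, forall i, G i (p.2 i), forall i, i \notin p.1 -> p.2 i = 0
    & x = \sum_(i <- p.1) p.2 i].
Proof.
have [s [f [hf ->]]] := hpart_span G x.
exists (undup s, fun i => f i *+ count_mem i s); split => /=.
- exact: undup_uniq.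
- by move=> i; rewrite -scaler_nat; apply: hpartZ.
- by move=> i; rewrite mem_undup => /count_memPn ->.
- rewrite -[in LHS](big_undup_iterop_count _ s) /=; apply: eq_bigr => i _.
  by rewrite Monoid.iteropE /= iter_addr addr0.
Qed.

Definition hsupp x : seq int := (projT1 (cid (hdecomp x))).1.
Definition hproj x : int -> V := (projT1 (cid (hdecomp x))).2.

Lemma hsupp_uniq x : uniq (hsupp x).
Proof. by rewrite /hsupp; case: cid => ? []. Qed.

Lemma hprojP x i : G i (hproj x i).
Proof. by rewrite /hproj; case: cid => ? []. Qed.

Lemma hproj0 x i : i \notin hsupp x -> hproj x i = 0.
Proof. by rewrite /hproj /hsupp; case: cid => ? [] /= _ _ + _; apply. Qed.

Lemma hprojE x : x = \sum_(i <- hsupp x) hproj x i.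
Proof. by rewrite {1}/hproj /hsupp; case: cid => ? []. Qed.

Lemma hproj_ind (P : V -> Prop) : P 0 -> (forall x y, P x -> P y -> P (x + y)) ->
  (forall i x, G i x -> P x) -> forall x, P x.
Proof.
move=> P0 PD Ph x; rewrite [x]hprojE; apply: big_ind => // i _.
exact: (Ph i (hproj x i) (hprojP x i)).
Qed.

(* The map sending [x] to the sum of the [h i x_i], with [x_i] the component
   of degree [i] of [x]. *)
Definition hlift (W : zmodType) (h : int -> V -> W) (x : V) : W :=
  \sum_(i <- hsupp x) h i (hproj x i).

Section Lift.
Variables (W : lmodType k) (h : int -> V -> W).
Hypothesis hl : forall i, linear (h i).

Lemma hlift_sum (s : seq int) (f : int -> V) : uniq s -> (forall i, G i (f i)) ->
  (forall i, i \notin s -> f i = 0) ->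
  hlift h (\sum_(i <- s) f i) = \sum_(i <- s) h i (f i).
Proof.
move=> us hf f0; set x := \sum_(i <- s) _.
pose u := undup (s ++ hsupp x); have uu : uniq u by apply: undup_uniq.
have su : {subset s <= u} by move=> i; rewrite mem_undup mem_cat => ->.
have xu : {subset hsupp x <= u}.
  by move=> i; rewrite mem_undup mem_cat => ->; rewrite orbT.
have e0 : \sum_(i <- u) (f i - hproj x i) = 0.
  rewrite sumrB (big_supp us uu su f0) (big_supp (hsupp_uniq x) uu xu) -?hprojE.
    by rewrite -/x subrr.
  exact: hproj0.
have ef : forall i, i \in u -> f i = hproj x i.
  move=> i iu; apply/subr0_eq; apply: (hpart_free (g := G) uu _ e0 iu).
  by move=> j; apply: hpartB => //; apply: hprojP.
rewrite -(big_supp us uu su); last by move=> i /f0 ->; rewrite lin0.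
rewrite /hlift -(big_supp (hsupp_uniq x) uu xu); last first.
  by move=> i /hproj0 ->; rewrite lin0.
by rewrite !big_seq; apply: eq_bigr => i /ef ->.
Qed.

Lemma hlift_homog i x : G i x -> hlift h x = h i x.
Proof.
move=> hx; pose f j := if j == i then x else 0.
have -> : x = \sum_(j <- [:: i]) f j by rewrite big_seq1 /f eqxx.
rewrite hlift_sum; first by rewrite !big_seq1.
- by [].
- by move=> j; rewrite /f; case: eqP => [->|_] //; exact: hpart0.
- by move=> j; rewrite inE /f => /negbTE ->.
Qed.

Lemma hlift_linear : linear (hlift h).
Proof.
move=> c x y.
pose u := undup (hsupp x ++ hsupp y); have uu : uniq u by apply: undup_uniq.
have xu : {subset hsupp x <= u} by move=> i; rewrite mem_undup mem_cat => ->.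
have yu : {subset hsupp y <= u}.
  by move=> i; rewrite mem_undup mem_cat => ->; rewrite orbT.
pose f i := c *: hproj x i + hproj y i.
have {1}-> : c *: x + y = \sum_(i <- u) f i.
  rewrite big_split /= -scaler_sumr (big_supp _ uu xu) ?hsupp_uniq //; last first.
    exact: hproj0.
  by rewrite (big_supp (hsupp_uniq y) uu yu (@hproj0 y)) -!hprojE.
rewrite hlift_sum //.
- under eq_bigr => i _ do rewrite hl.
  rewrite big_split /= -scaler_sumr (big_supp (hsupp_uniq x) uu xu).
    rewrite (big_supp (hsupp_uniq y) uu yu) // => i /hproj0 ->.
    by rewrite lin0.
  by move=> i /hproj0 ->; rewrite lin0.
- by move=> i; apply: hpartP; apply: hprojP.
- move=> i; rewrite mem_undup mem_cat negb_or => /andP[/hproj0 ex /hproj0 ey].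
  by rewrite /f ex ey scaler0 addr0.
Qed.

End Lift.

Lemma homog_ext (W : lmodType k) (f g : V -> W) : linear f -> linear g ->
  (forall i x, G i x -> f x = g x) -> f =1 g.
Proof.
move=> fl gl; apply: hproj_ind; first by rewrite !lin0.
by move=> x y ex ey; rewrite !linD // ex ey.
Qed.

End GradingTheory.

Section Signs.
Variable k : fieldType.
Implicit Types i j : int.

Lemma sgD i j : (-1) ^ (i + j) = (-1) ^ i * (-1) ^ j :> k.
Proof. by rewrite expfzDr // oppr_eq0 oner_eq0. Qed.

Lemma sgM i : (-1) ^ i * (-1) ^ i = 1 :> k.
Proof. by rewrite -expfzMl mulrNN mulr1 exp1rz. Qed.

Lemma sgV (W : lmodType k) i (x y : W) : x = (-1) ^ i *: y -> y = (-1) ^ i *: x.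
Proof. by move=> ->; rewrite scalerA sgM scale1r. Qed.
End Signs.

Section Commutator.
Variables (k : fieldType) (D : dgAlg k).

(* The map [(x, y) |-> (-1)^(|x||y|) y x], extended bilinearly. *)
Definition gswap (x y : D) : D :=
  hlift (dga_gr D) (fun i xi =>
    hlift (dga_gr D) (fun j yj => (-1) ^ (i * j) *: (yj * xi)) y) x.

(* For homogeneous [x] and [y] this is the graded commutator, see [gcommE]. *)
Definition gcomm (x y : D) : D := x * y - gswap x y.

End Commutator.
Section CommutatorTheory.
Variables (k : fieldType) (D : dgAlg k).
Notation G := (dga_gr D).
Implicit Types (i j : int) (x y : D).

Fact sw_linl i x j : linear (fun y : D => (-1) ^ (i * j) *: (y * x)).
Proof.
by move=> c y y'; rewrite mulrDl -pzscalerAl scalerDr !scalerA [_ * c]mulrC.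
Qed.

Fact sw_linr i y : linear (fun x : D => hlift G (fun j yj => (-1) ^ (i * j) *: (yj * x)) y).
Proof.
move=> c x x'; rewrite /hlift scaler_sumr -big_split /=; apply: eq_bigr => j _.
by rewrite mulrDr -pzscalerAr scalerDr !scalerA [_ * c]mulrC.
Qed.

Lemma gswap_bilin : bilin (@gswap k D).
Proof.
split=> [x|y]; last by apply: hlift_linear => i; apply: sw_linr.
move=> c y y'; rewrite /gswap /hlift scaler_sumr -big_split /=.
by apply: eq_bigr => i _; exact: (hlift_linear G (sw_linl i (hproj G x i)) c y y').
Qed.

Lemma gswapE i j x y : G i x -> G j y -> gswap x y = (-1) ^ (i * j) *: (y * x).
Proof.
move=> hx hy; rewrite /gswap (hlift_homog _ hx); last by move=> ?; apply: sw_linr.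
by rewrite (hlift_homog _ hy) // => ?; apply: sw_linl.
Qed.

Lemma gcommE i j x y : homog D i x -> homog D j y ->
  gcomm x y = x * y - (-1) ^ (i * j) *: (y * x).
Proof. by move=> hx hy; rewrite /gcomm (gswapE hx hy). Qed.

Lemma gcomm_bilin : bilin (@gcomm k D).
Proof.
split=> [x|y] c z z'; rewrite /gcomm.
  rewrite gswap_bilin.1 mulrDr -pzscalerAr scalerBr opprD.
  by rewrite (AC (2*2) ((1*3)*(2*4))).
rewrite gswap_bilin.2 mulrDl -pzscalerAl scalerBr opprD.
by rewrite (AC (2*2) ((1*3)*(2*4))).
Qed.

Lemma gcomm_deg i j x y : homog D i x -> homog D j y -> homog D (i + j) (gcomm x y).
Proof.
move=> hx hy; rewrite (gcommE hx hy); apply: (hpartB (G := G)).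
  exact: dga_degM.
by apply: (hpartZ (G := G)); rewrite addrC; apply: dga_degM.
Qed.

Lemma gcomm_isDGLie : isDGLie (L := D) (@gcomm k D).
Proof.
have exl (f g : D -> D) := @homog_ext k D G D f g.
split; [exact: gcomm_bilin | exact: gcomm_deg | | |].
- move=> i j a b ha hb; rewrite (gcommE ha hb) (gcommE hb ha) scalerBr scalerA.
  by rewrite [j * i]mulrC sgM scale1r opprB.
- move=> i j a b c ha hb; move: c; refine (exl (fun c => _) (fun c => _) _ _ _) => [c x y|c x y|l c hc].
  + by rewrite !gcomm_bilin.1.
  + rewrite !gcomm_bilin.1 !scalerDr !scalerA [c * _]mulrC.
    by rewrite (AC (2*2) ((1*3)*(2*4))).
  rewrite (gcommE ha (gcomm_deg hb hc)) (gcommE (gcomm_deg ha hb) hc).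
  rewrite (gcommE hb (gcomm_deg ha hc)) (gcommE ha hb) (gcommE ha hc) (gcommE hb hc).
  rewrite !mulrDr !mulrDl [j * i]mulrC !sgD.
  set p := (-1) ^ (i * j); set q := (-1) ^ (i * l); set r := (-1) ^ (j * l).
  have pp : p * p = 1 by apply: sgM.
  rewrite !(mulrN, mulNr) -!pzscalerAr -!pzscalerAl !(scalerBr, scalerN, opprB, opprD, opprK) !scalerA.
  rewrite !mulrA pp !mul1r [r * q]mulrC [q * r * p]mulrC mulrA.
  by rewrite [RHS](AC ((2*2)*(2*2)) (((1*8)*(3*6))*((2*5)*(4*7)))) /= !addNr !addr0.
- move=> i a b ha; move: b; refine (exl (fun b => _) (fun b => _) _ _ _) => [c x y|c x y|j b hb].
  + by rewrite gcomm_bilin.1 /dgd /= linearP.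
  + rewrite /dgd /= linearP !gcomm_bilin.1 !scalerDr !scalerA [c * _]mulrC.
    by rewrite (AC (2*2) ((1*3)*(2*4))).
  have hda : homog D (i + 1) (dgd D a) by apply: dga_d_deg.
  have hdb : homog D (j + 1) (dgd D b) by apply: dga_d_deg.
  rewrite (gcommE ha hb) (gcommE hda hb) (gcommE ha hdb) /dgd /= linearB linearZ /=.
  rewrite (dga_dM _ ha) (dga_dM _ hb) mulrDr mulrDl !sgD mul1r mulr1.
  rewrite !(scalerDr, scalerN) !scalerA [_ * (_ * (-1) ^ i)]mulrCA sgM mulr1 opprD.
  by rewrite [LHS](AC (2*2) ((1*4)*(2*3))).
Qed.

Definition dgLie_of_dgAlg : dgLie k := DGLie gcomm_isDGLie.

End CommutatorTheory.

Section Presentation.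
Variables (k : fieldType) (A : dgPoisson k).

(* Noncommutative polynomial expressions in the generators [m_a] and [h_a]. *)
Inductive Ae_term : Type :=
| tM of A
| tH of A
| t0
| t1
| tadd of Ae_term & Ae_term
| tscale of k & Ae_term
| tmul of Ae_term & Ae_term.

(* The congruence generated by the axioms of [k]-algebras, the linearity of
   [a |-> m_a] and [a |-> h_a], and the defining relations. *)
Inductive Ae_eqv : Ae_term -> Ae_term -> Prop :=
| eqv_refl s : Ae_eqv s s
| eqv_sym s t : Ae_eqv s t -> Ae_eqv t s
| eqv_trans s t u : Ae_eqv s t -> Ae_eqv t u -> Ae_eqv s u
| eqv_add s s' t t' :
    Ae_eqv s s' -> Ae_eqv t t' -> Ae_eqv (tadd s t) (tadd s' t')
| eqv_scale c s s' : Ae_eqv s s' -> Ae_eqv (tscale c s) (tscale c s')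
| eqv_mul s s' t t' :
    Ae_eqv s s' -> Ae_eqv t t' -> Ae_eqv (tmul s t) (tmul s' t')
| eqv_addA s t u : Ae_eqv (tadd s (tadd t u)) (tadd (tadd s t) u)
| eqv_addC s t : Ae_eqv (tadd s t) (tadd t s)
| eqv_add0 s : Ae_eqv (tadd t0 s) s
| eqv_addN s : Ae_eqv (tadd (tscale (-1) s) s) t0
| eqv_scaleA c c' s : Ae_eqv (tscale c (tscale c' s)) (tscale (c * c') s)
| eqv_scale1 s : Ae_eqv (tscale 1 s) s
| eqv_scaleDr c s t :
    Ae_eqv (tscale c (tadd s t)) (tadd (tscale c s) (tscale c t))
| eqv_scaleDl c c' s :
    Ae_eqv (tscale (c + c') s) (tadd (tscale c s) (tscale c' s))
| eqv_mulA s t u : Ae_eqv (tmul s (tmul t u)) (tmul (tmul s t) u)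
| eqv_mul1l s : Ae_eqv (tmul t1 s) s
| eqv_mul1r s : Ae_eqv (tmul s t1) s
| eqv_mulDl s t u : Ae_eqv (tmul (tadd s t) u) (tadd (tmul s u) (tmul t u))
| eqv_mulDr s t u : Ae_eqv (tmul s (tadd t u)) (tadd (tmul s t) (tmul s u))
| eqv_scaleAl c s t : Ae_eqv (tscale c (tmul s t)) (tmul (tscale c s) t)
| eqv_scaleAr c s t : Ae_eqv (tscale c (tmul s t)) (tmul s (tscale c t))
| eqv_M_lin c a b : Ae_eqv (tM (c *: a + b)) (tadd (tscale c (tM a)) (tM b))
| eqv_H_lin c a b : Ae_eqv (tH (c *: a + b)) (tadd (tscale c (tH a)) (tH b))
| eqv_MM i j a b : homog A i a -> homog A j b ->
    Ae_eqv (tM (a * b)) (tmul (tM a) (tM b))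
| eqv_HM i j a b : homog A i a -> homog A j b ->
    Ae_eqv (tH (a * b))
      (tadd (tmul (tM a) (tH b)) (tscale ((-1) ^ (i * j)) (tmul (tM b) (tH a))))
| eqv_Mbr i j a b : homog A i a -> homog A j b ->
    Ae_eqv (tM (pbr a b))
      (tadd (tmul (tH a) (tM b))
            (tscale (- (-1) ^ (i * j)) (tmul (tM b) (tH a))))
| eqv_Hbr i j a b : homog A i a -> homog A j b ->
    Ae_eqv (tH (pbr a b))
      (tadd (tmul (tH a) (tH b))
            (tscale (- (-1) ^ (i * j)) (tmul (tH b) (tH a))))
| eqv_M1 : Ae_eqv (tM 1) t1.

HB.instance Definition _ := gen_eqMixin Ae_term.
HB.instance Definition _ := gen_choiceMixin Ae_term.

Let eqvb (s t : Ae_term) : bool := `[< Ae_eqv s t >].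

Fact eqvb_refl : reflexive eqvb.
Proof. by move=> s; apply/asboolP; apply: eqv_refl. Qed.

Fact eqvb_sym : symmetric eqvb.
Proof. by move=> s t; apply/asboolP/asboolP; apply: eqv_sym. Qed.

Fact eqvb_trans : transitive eqvb.
Proof.
move=> t s u /asboolP est /asboolP etu; apply/asboolP; exact: eqv_trans etu.
Qed.

Definition Ae_equiv : equiv_rel Ae_term := EquivRel eqvb eqvb_refl eqvb_sym eqvb_trans.

Definition Ae_car : Type := {eq_quot Ae_equiv}%qT.

HB.instance Definition _ := Choice.copy Ae_car {eq_quot Ae_equiv}%qT.

Definition Ae_pi (t : Ae_term) : Ae_car := (\pi_({eq_quot Ae_equiv}) t)%qT.
Definition Ae_repr (x : Ae_car) : Ae_term := repr (x : {eq_quot Ae_equiv}%qT).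

Lemma Ae_reprK x : Ae_pi (Ae_repr x) = x.
Proof. exact: reprK. Qed.

Lemma Ae_eq s t : Ae_pi s = Ae_pi t <-> Ae_eqv s t.
Proof.
split=> [/eqquotP /asboolP //|est].
by apply/eqquotP; apply/asboolP.
Qed.

Lemma Ae_repr_eqv t : Ae_eqv (Ae_repr (Ae_pi t)) t.
Proof. by apply/Ae_eq; rewrite Ae_reprK. Qed.

Definition Ae_zero := Ae_pi t0.
Definition Ae_one := Ae_pi t1.
Definition Ae_add x y := Ae_pi (tadd (Ae_repr x) (Ae_repr y)).
Definition Ae_scale c x := Ae_pi (tscale c (Ae_repr x)).
Definition Ae_opp x := Ae_scale (-1) x.
Definition Ae_mul x y := Ae_pi (tmul (Ae_repr x) (Ae_repr y)).

Lemma Ae_piD s t : Ae_add (Ae_pi s) (Ae_pi t) = Ae_pi (tadd s t).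
Proof. by apply/Ae_eq; apply: eqv_add; apply: Ae_repr_eqv. Qed.
Lemma Ae_piZ c s : Ae_scale c (Ae_pi s) = Ae_pi (tscale c s).
Proof. by apply/Ae_eq; apply: eqv_scale; apply: Ae_repr_eqv. Qed.
Lemma Ae_piM s t : Ae_mul (Ae_pi s) (Ae_pi t) = Ae_pi (tmul s t).
Proof. by apply/Ae_eq; apply: eqv_mul; apply: Ae_repr_eqv. Qed.

Let piE := (Ae_piD, Ae_piZ, Ae_piM).

Lemma Ae_ind (P : Ae_car -> Prop) : (forall t, P (Ae_pi t)) -> forall x, P x.
Proof. by move=> h x; rewrite -[x]Ae_reprK. Qed.

Fact Ae_addA : associative Ae_add.
Proof.
elim/Ae_ind=> s; elim/Ae_ind=> t; elim/Ae_ind=> u.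
by rewrite !piE; apply/Ae_eq; apply: eqv_addA.
Qed.
Fact Ae_addC : commutative Ae_add.
Proof.
by elim/Ae_ind=> s; elim/Ae_ind=> t; rewrite !piE; apply/Ae_eq; apply: eqv_addC.
Qed.
Fact Ae_add0 : left_id Ae_zero Ae_add.
Proof. by elim/Ae_ind=> s; rewrite !piE; apply/Ae_eq; apply: eqv_add0. Qed.
Fact Ae_addN : left_inverse Ae_zero Ae_opp Ae_add.
Proof.
by elim/Ae_ind=> s; rewrite /Ae_opp !piE; apply/Ae_eq; apply: eqv_addN.
Qed.
HB.instance Definition _ :=
  GRing.isZmodule.Build Ae_car Ae_addA Ae_addC Ae_add0 Ae_addN.

Fact Ae_mulA : associative Ae_mul.
Proof.
elim/Ae_ind=> s; elim/Ae_ind=> t; elim/Ae_ind=> u.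
by rewrite !piE; apply/Ae_eq; apply: eqv_mulA.
Qed.
Fact Ae_mul1l : left_id Ae_one Ae_mul.
Proof. by elim/Ae_ind=> s; rewrite !piE; apply/Ae_eq; apply: eqv_mul1l. Qed.
Fact Ae_mul1r : right_id Ae_one Ae_mul.
Proof. by elim/Ae_ind=> s; rewrite !piE; apply/Ae_eq; apply: eqv_mul1r. Qed.
Fact Ae_mulDl : left_distributive Ae_mul +%R.
Proof.
elim/Ae_ind=> s; elim/Ae_ind=> t; elim/Ae_ind=> u.
by rewrite /GRing.add /= !piE; apply/Ae_eq; apply: eqv_mulDl.
Qed.
Fact Ae_mulDr : right_distributive Ae_mul +%R.
Proof.
elim/Ae_ind=> s; elim/Ae_ind=> t; elim/Ae_ind=> u.
by rewrite /GRing.add /= !piE; apply/Ae_eq; apply: eqv_mulDr.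
Qed.
HB.instance Definition _ :=
  GRing.Zmodule_isPzRing.Build Ae_car Ae_mulA Ae_mul1l Ae_mul1r Ae_mulDl Ae_mulDr.

Fact Ae_scaleA c c' x : Ae_scale c (Ae_scale c' x) = Ae_scale (c * c') x.
Proof. by elim/Ae_ind: x => s; rewrite !piE; apply/Ae_eq; apply: eqv_scaleA. Qed.
Fact Ae_scale1 : left_id 1 Ae_scale.
Proof. by elim/Ae_ind=> s; rewrite !piE; apply/Ae_eq; apply: eqv_scale1. Qed.
Fact Ae_scaleDr : right_distributive Ae_scale +%R.
Proof.
move=> c; elim/Ae_ind=> s; elim/Ae_ind=> t.
by rewrite /GRing.add /= !piE; apply/Ae_eq; apply: eqv_scaleDr.
Qed.
Fact Ae_scaleDl x : {morph Ae_scale^~ x : c c' / c + c'}.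
Proof.
move=> c c'; elim/Ae_ind: x => s.
by rewrite /= [in RHS]/GRing.add /= !piE; apply/Ae_eq; apply: eqv_scaleDl.
Qed.

Definition Ae_lmod : GRing.Zmodule_isLmodule k Ae_car :=
  GRing.Zmodule_isLmodule.Build k Ae_car Ae_scaleA Ae_scale1 Ae_scaleDr Ae_scaleDl.

Fact Ae_scaleAl c (x y : Ae_car) : Ae_scale c (x * y) = Ae_scale c x * y.
Proof.
elim/Ae_ind: x => s; elim/Ae_ind: y => t.
by rewrite /GRing.mul /= !piE; apply/Ae_eq; apply: eqv_scaleAl.
Qed.
Fact Ae_scaleAr c (x y : Ae_car) : Ae_scale c (x * y) = x * Ae_scale c y.
Proof.
elim/Ae_ind: x => s; elim/Ae_ind: y => t.
by rewrite /GRing.mul /= !piE; apply/Ae_eq; apply: eqv_scaleAr.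
Qed.

Definition Ae_alg : pzAlgType k :=
  @PzAlgType k Ae_car Ae_lmod Ae_scaleAl Ae_scaleAr.

Definition Ae_m (a : A) : Ae_alg := Ae_pi (tM a).
Definition Ae_h (a : A) : Ae_alg := Ae_pi (tH a).

End Presentation.
Section EvalTerm.
Variables (k : fieldType) (A : dgPoisson k) (B : pzAlgType k) (f g : A -> B).

Fixpoint Ae_eval (t : Ae_term A) : B :=
  match t with
  | tM a => f a
  | tH a => g a
  | t0 => 0
  | t1 => 1
  | tadd s t => Ae_eval s + Ae_eval t
  | tscale c s => c *: Ae_eval s
  | tmul s t => Ae_eval s * Ae_eval t
  end.

Hypotheses (fl : linear f) (gl : linear g) (f1 : f 1 = 1).
Hypothesis fM : forall i j a b, homog A i a -> homog A j b -> f (a * b) = f a * f b.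
Hypothesis gM : forall i j a b, homog A i a -> homog A j b ->
  g (a * b) = f a * g b + (-1) ^ (i * j) *: (f b * g a).
Hypothesis fbr : forall i j a b, homog A i a -> homog A j b ->
  f (pbr a b) = g a * f b - (-1) ^ (i * j) *: (f b * g a).
Hypothesis gbr : forall i j a b, homog A i a -> homog A j b ->
  g (pbr a b) = g a * g b - (-1) ^ (i * j) *: (g b * g a).

Lemma Ae_eval_eqv s t : Ae_eqv s t -> Ae_eval s = Ae_eval t.
Proof.
elim=> {s t} //=.
- by move=> s t u _ -> _ ->.
- by move=> s s' t t' _ -> _ ->.
- by move=> c s s' _ ->.
- by move=> s s' t t' _ -> _ ->.
- by move=> s t u; rewrite addrA.
- by move=> s t; rewrite addrC.
- by move=> s; rewrite add0r.
- by move=> s; rewrite scaleN1r addNr.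
- by move=> c c' s; rewrite scalerA.
- by move=> s; rewrite scale1r.
- by move=> c s t; rewrite scalerDr.
- by move=> c c' s; rewrite scalerDl.
- by move=> s t u; rewrite mulrA.
- by move=> s; rewrite mul1r.
- by move=> s; rewrite mulr1.
- by move=> s t u; rewrite mulrDl.
- by move=> s t u; rewrite mulrDr.
- by move=> c s t; rewrite pzscalerAl.
- by move=> c s t; rewrite pzscalerAr.
- by move=> i j a b ha hb; rewrite scaleNr; apply: fbr.
- by move=> i j a b ha hb; rewrite scaleNr; apply: gbr.
Qed.

End EvalTerm.

Section AeTheory.
Variables (k : fieldType) (A : dgPoisson k).
Notation E := (Ae_alg A).
Notation G := (dga_gr A).
Notation pi := (@Ae_pi k A : Ae_term A -> E).
Notation m := (@Ae_m k A).
Notation h := (@Ae_h k A).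
Implicit Types (x y : E) (a b : A) (i j : int).

Lemma Ae_0 : (0 : E) = pi (t0 A). Proof. by []. Qed.
Lemma Ae_1 : (1 : E) = pi (t1 A). Proof. by []. Qed.
Lemma Ae_D s t : pi s + pi t = pi (tadd s t). Proof. exact: Ae_piD. Qed.
Lemma Ae_M s t : pi s * pi t = pi (tmul s t). Proof. exact: Ae_piM. Qed.
Lemma Ae_Z c s : c *: pi s = pi (tscale c s). Proof. exact: Ae_piZ. Qed.

Lemma Ae_gen_ind (P : E -> Prop) :
  (forall a, P (m a)) -> (forall a, P (h a)) -> P 0 -> P 1 ->
  (forall x y, P x -> P y -> P (x + y)) ->
  (forall c x, P x -> P (c *: x)) ->
  (forall x y, P x -> P y -> P (x * y)) ->
  forall x, P x.
Proof.
move=> Pm Ph P0 P1 PD PZ PM; apply: Ae_ind; elim=> //.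
- by move=> s Ps t Pt; rewrite -Ae_D; apply: PD.
- by move=> c s Ps; rewrite -Ae_Z; apply: PZ.
- by move=> s Ps t Pt; rewrite -Ae_M; apply: PM.
Qed.

Lemma Ae_m_linear : linear m.
Proof. by move=> c a b; rewrite /Ae_m Ae_Z Ae_D; apply/Ae_eq/eqv_M_lin. Qed.

Lemma Ae_h_linear : linear h.
Proof. by move=> c a b; rewrite /Ae_h Ae_Z Ae_D; apply/Ae_eq/eqv_H_lin. Qed.

Lemma Ae_m1 : m 1 = 1.
Proof. exact/Ae_eq/eqv_M1. Qed.

Lemma Ae_mM_homog i j a b : homog A i a -> homog A j b -> m (a * b) = m a * m b.
Proof. by move=> ha hb; rewrite Ae_M; apply/Ae_eq; apply: eqv_MM ha hb. Qed.

Lemma Ae_mM a b : m (a * b) = m a * m b.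
Proof.
move: a b; pose L := linD Ae_m_linear; pose L0 := lin0 Ae_m_linear.
apply: (hproj_ind (G := G)) => [b|a a' ha ha' b|i a ha].
- by rewrite mul0r L0 mul0r.
- by rewrite mulrDl !L mulrDl ha ha'.
apply: (hproj_ind (G := G)) => [|b b' hb hb'|j b hb].
- by rewrite mulr0 L0 mulr0.
- by rewrite mulrDr !L mulrDr hb hb'.
- exact: Ae_mM_homog ha hb.
Qed.

Lemma Ae_hM i j a b : homog A i a -> homog A j b ->
  h (a * b) = m a * h b + (-1) ^ (i * j) *: (m b * h a).
Proof. by move=> ha hb; rewrite !Ae_M Ae_Z Ae_D; apply/Ae_eq/eqv_HM. Qed.

Lemma Ae_mbr i j a b : homog A i a -> homog A j b ->
  m (pbr a b) = h a * m b - (-1) ^ (i * j) *: (m b * h a).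
Proof.
by move=> ha hb; rewrite -scaleNr !Ae_M Ae_Z Ae_D; apply/Ae_eq/eqv_Mbr.
Qed.

Lemma Ae_hbr i j a b : homog A i a -> homog A j b ->
  h (pbr a b) = h a * h b - (-1) ^ (i * j) *: (h b * h a).
Proof.
by move=> ha hb; rewrite -scaleNr !Ae_M Ae_Z Ae_D; apply/Ae_eq/eqv_Hbr.
Qed.

(* The sign involution of [A], then of its enveloping algebra. *)
Definition dg_eps : A -> A := hlift G (fun i (a : A) => (-1) ^ i *: a).

Fact dg_eps_hl i : linear (fun a : A => (-1) ^ i *: a).
Proof. by move=> c a b; rewrite scalerDr !scalerA mulrC. Qed.

Lemma dg_eps_linear : linear dg_eps.
Proof. exact: hlift_linear dg_eps_hl. Qed.

Lemma dg_epsE i a : homog A i a -> dg_eps a = (-1) ^ i *: a.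
Proof. by move=> ha; rewrite /dg_eps (hlift_homog _ ha) //; apply: dg_eps_hl. Qed.

Definition Ae_eps (x : E) : E :=
  Ae_eval (fun a => m (dg_eps a)) (fun a => h (dg_eps a)) (Ae_repr x).

Lemma Ae_eps_pi t :
  Ae_eps (pi t) = Ae_eval (fun a => m (dg_eps a)) (fun a => h (dg_eps a)) t.
Proof.
pose mZ := linZ Ae_m_linear; pose hZ := linZ Ae_h_linear.
apply: (Ae_eval_eqv _ _ _ _ _ _ _ (Ae_repr_eqv t)).
- by move=> c a b; rewrite dg_eps_linear Ae_m_linear.
- by move=> c a b; rewrite dg_eps_linear Ae_h_linear.
- rewrite (dg_epsE (i := 0)) ?expr0z ?scale1r ?Ae_m1 //; exact: dga_deg1.
- move=> i j a b ha hb; rewrite (dg_epsE (dga_degM ha hb)) (dg_epsE ha) (dg_epsE hb).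
  by rewrite !mZ Ae_mM -pzscalerAl -pzscalerAr scalerA sgD.
- move=> i j a b ha hb; rewrite (dg_epsE (dga_degM ha hb)) (dg_epsE ha) (dg_epsE hb).
  rewrite !mZ !hZ (Ae_hM ha hb) -!pzscalerAl -!pzscalerAr !scalerDr !scalerA sgD.
  by congr (_ + _ *: _); rewrite [RHS]mulrC [X in _ = X * _]mulrC.
- move=> i j a b ha hb; rewrite (dg_epsE (dgl_deg (pbr_lie A) ha hb)) (dg_epsE ha) (dg_epsE hb).
  rewrite !mZ !hZ (Ae_mbr ha hb) -!pzscalerAl -!pzscalerAr !scalerBr !scalerA sgD.
  by congr (_ - _ *: _); rewrite [RHS]mulrC [X in _ = X * _]mulrC.
- move=> i j a b ha hb; rewrite (dg_epsE (dgl_deg (pbr_lie A) ha hb)) (dg_epsE ha) (dg_epsE hb).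
  rewrite !hZ (Ae_hbr ha hb) -!pzscalerAl -!pzscalerAr !scalerBr !scalerA sgD.
  by congr (_ - _ *: _); rewrite [RHS]mulrC [X in _ = X * _]mulrC.
Qed.

Lemma Ae_eps_linear : linear Ae_eps.
Proof.
move=> c; elim/Ae_ind=> s; elim/Ae_ind=> t.
by rewrite Ae_Z Ae_D !Ae_eps_pi.
Qed.

Lemma Ae_eps1 : Ae_eps 1 = 1.
Proof. by rewrite Ae_1 Ae_eps_pi. Qed.

Lemma Ae_epsM x y : Ae_eps (x * y) = Ae_eps x * Ae_eps y.
Proof.
by elim/Ae_ind: x => s; elim/Ae_ind: y => t; rewrite Ae_M !Ae_eps_pi.
Qed.

Lemma Ae_eps_m i a : homog A i a -> Ae_eps (m a) = (-1) ^ i *: m a.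
Proof. by move=> ha; rewrite Ae_eps_pi /= (dg_epsE ha) (linZ Ae_m_linear). Qed.

Lemma Ae_eps_h i a : homog A i a -> Ae_eps (h a) = (-1) ^ i *: h a.
Proof. by move=> ha; rewrite Ae_eps_pi /= (dg_epsE ha) (linZ Ae_h_linear). Qed.

(* On products: [d (s t) = (d s) t + (-1)^|s| s (d t)]. *)
Fixpoint Ae_dterm (t : Ae_term A) : E :=
  match t with
  | tM a => m (dgd A a)
  | tH a => h (dgd A a)
  | t0 => 0
  | t1 => 0
  | tadd s t => Ae_dterm s + Ae_dterm t
  | tscale c s => c *: Ae_dterm s
  | tmul s t => Ae_dterm s * pi t + Ae_eps (pi s) * Ae_dterm t
  end.

Lemma dgd_linear (V : dgVect k) : linear (dgd V).
Proof. by move=> c x y; rewrite /dgd linearP. Qed.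

Lemma dgd_deg (V : dgVect k) i (x : V) : homog V i x -> homog V (i + 1) (dgd V x).
Proof. exact: dgv_d_deg. Qed.

Lemma dgd_mul (D : dgAlg k) i (x y : D) : homog D i x ->
  dgd D (x * y) = dgd D x * y + (-1) ^ i *: (x * dgd D y).
Proof. exact: dga_dM. Qed.

Lemma dga_d1 (D : dgAlg k) : dgd D (1 : D) = 0.
Proof.
apply: (addIr (dgd D (1 : D))); rewrite add0r.
have := dgd_mul (1 : D) (dga_deg1 D); rewrite expr0z scale1r !mulr1 mul1r.
by move=> <-.
Qed.

Lemma Ae_dterm_eqv s t : Ae_eqv s t -> Ae_dterm s = Ae_dterm t.
Proof.
pose mZ := linZ Ae_m_linear; pose hZ := linZ Ae_h_linear.
pose mD := linD Ae_m_linear; pose hD := linD Ae_h_linear.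
elim=> {s t} //=.
- by move=> s t u _ -> _ ->.
- by move=> s s' t t' _ -> _ ->.
- by move=> c s s' _ ->.
- by move=> s s' t t' /Ae_eq -> -> /Ae_eq -> ->.
- by move=> s t u; rewrite addrA.
- by move=> s t; rewrite addrC.
- by move=> s; rewrite add0r.
- by move=> s; rewrite scaleN1r addNr.
- by move=> c c' s; rewrite scalerA.
- by move=> s; rewrite scale1r.
- by move=> c s t; rewrite scalerDr.
- by move=> c c' s; rewrite scalerDl.
- by move=> s t u; rewrite -!Ae_M Ae_epsM mulrDl mulrDr !mulrA addrA.
- by move=> s; rewrite -Ae_1 Ae_eps1 mul1r mul0r add0r.
- by move=> s; rewrite mulr1 mulr0 addr0.
- move=> s t u; rewrite -!Ae_D (linD Ae_eps_linear) !mulrDl.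
  by rewrite (AC (2*2) ((1*3)*(2*4))).
- move=> s t u; rewrite -!Ae_D !mulrDr.
  by rewrite (AC (2*2) ((1*3)*(2*4))).
- by move=> c s t; rewrite -!Ae_Z (linZ Ae_eps_linear) -!pzscalerAl scalerDr.
- by move=> c s t; rewrite -!Ae_Z -!pzscalerAr scalerDr.
- by move=> c a b; rewrite dgd_linear Ae_m_linear.
- by move=> c a b; rewrite dgd_linear Ae_h_linear.
- move=> i j a b ha hb; rewrite (dgd_mul _ ha) mD mZ !Ae_mM (Ae_eps_m ha).
  by rewrite -pzscalerAl.
- move=> i j a b ha hb; have hda := dgd_deg ha; have hdb := dgd_deg hb.
  rewrite (dgd_mul _ ha) hD hZ (Ae_hM hda hb) (Ae_hM ha hdb).
  rewrite (Ae_eps_m ha) (Ae_eps_m hb) -!pzscalerAl !scalerDr !scalerA.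
  rewrite mulrDl mulrDr !sgD mul1r mulr1 [X in _ + (_ + X *: _)]mulrCA sgM mulr1.
  by rewrite [LHS](AC (2*2) ((1*3)*(4*2))).
- move=> i j a b ha hb; have hda := dgd_deg ha; have hdb := dgd_deg hb.
  rewrite (dgl_d (pbr_lie A) _ ha) mD mZ (Ae_mbr hda hb) (Ae_mbr ha hdb).
  rewrite (Ae_eps_m hb) (Ae_eps_h ha) -!pzscalerAl !(scalerDr, scalerBr, scalerN) !scalerA !scaleNr.
  rewrite mulrDl mulrDr !sgD mul1r mulr1 [X in _ + (_ - X *: _)]mulrCA sgM mulr1 mulNr scaleNr.
  by rewrite [LHS](AC (2*2) ((1*3)*(4*2))).
- move=> i j a b ha hb; have hda := dgd_deg ha; have hdb := dgd_deg hb.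
  rewrite (dgl_d (pbr_lie A) _ ha) hD hZ (Ae_hbr hda hb) (Ae_hbr ha hdb).
  rewrite (Ae_eps_h hb) (Ae_eps_h ha) -!pzscalerAl !(scalerDr, scalerBr, scalerN) !scalerA !scaleNr.
  rewrite mulrDl mulrDr !sgD mul1r mulr1 [X in _ + (_ - X *: _)]mulrCA sgM mulr1 mulNr scaleNr.
  by rewrite [LHS](AC (2*2) ((1*3)*(4*2))).
- by rewrite dga_d1 (lin0 Ae_m_linear).
Qed.

(* The differential: by [Ae_d_m], [Ae_d_h] and [Ae_d_leibniz] below it sends
   [m_a] to [m_(d a)], [h_a] to [h_(d a)] and satisfies the Leibniz rule. *)
Definition Ae_d (x : E) : E := Ae_dterm (Ae_repr x).

Lemma Ae_d_pi t : Ae_d (pi t) = Ae_dterm t.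
Proof. exact: Ae_dterm_eqv (Ae_repr_eqv t). Qed.

Fact Ae_d_linear : linear Ae_d.
Proof.
move=> c; elim/Ae_ind=> s; elim/Ae_ind=> t.
by rewrite Ae_Z Ae_D !Ae_d_pi.
Qed.

HB.instance Definition _ := GRing.isLinear.Build k E E *:%R Ae_d Ae_d_linear.

Lemma Ae_d_m a : Ae_d (m a) = m (dgd A a).
Proof. exact: Ae_d_pi. Qed.

Lemma Ae_d_h a : Ae_d (h a) = h (dgd A a).
Proof. exact: Ae_d_pi. Qed.

Lemma Ae_d1 : Ae_d 1 = 0.
Proof. exact: Ae_d_pi. Qed.

Lemma Ae_dM x y : Ae_d (x * y) = Ae_d x * y + Ae_eps x * Ae_d y.
Proof.
by elim/Ae_ind: x => s; elim/Ae_ind: y => t; rewrite Ae_M !Ae_d_pi.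
Qed.

(* The component of degree [n] is spanned by the words of degree [n] in the
   [m_a] and [h_a] with [a] homogeneous. *)
Inductive Ae_word : int -> E -> Prop :=
| word1 : Ae_word 0 1
| word_m i j a x : homog A i a -> Ae_word j x -> Ae_word (i + j) (m a * x)
| word_h i j a x : homog A i a -> Ae_word j x -> Ae_word (i + j) (h a * x).

Inductive Ae_hpart (n : int) : E -> Prop :=
| Ae_hpart0 : Ae_hpart n 0
| Ae_hpartS c x y : Ae_word n x -> Ae_hpart n y -> Ae_hpart n (c *: x + y).

Lemma Ae_hpart_word n x : Ae_word n x -> Ae_hpart n x.
Proof.
by move=> hx; rewrite -[x]scale1r -[_ *: _]addr0; do 2?constructor.
Qed.

Lemma Ae_hpartP n c x y : Ae_hpart n x -> Ae_hpart n y -> Ae_hpart n (c *: x + y).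
Proof.
elim=> [|c' x1 x2 h1 _ IH] hy; first by rewrite scaler0 add0r.
rewrite scalerDr scalerA -addrA; constructor => //; exact: IH.
Qed.

Lemma Ae_hpartD n x y : Ae_hpart n x -> Ae_hpart n y -> Ae_hpart n (x + y).
Proof. by move=> hx hy; rewrite -[x]scale1r; apply: Ae_hpartP. Qed.

Lemma Ae_hpartZ n c x : Ae_hpart n x -> Ae_hpart n (c *: x).
Proof. by move=> hx; rewrite -[_ *: _]addr0; apply: Ae_hpartP => //; constructor. Qed.

Lemma Ae_wordM i j x y : Ae_word i x -> Ae_word j y -> Ae_word (i + j) (x * y).
Proof.
move=> hx hy; elim: hx => [|i1 i2 a x1 ha _ IH|i1 i2 a x1 ha _ IH].
- by rewrite add0r mul1r.
- by rewrite -addrA -mulrA; apply: word_m.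
- by rewrite -addrA -mulrA; apply: word_h.
Qed.

Lemma Ae_hpartM i j x y : Ae_hpart i x -> Ae_hpart j y -> Ae_hpart (i + j) (x * y).
Proof.
move=> hx hy; elim: hx => [|c x1 x2 h1 _ IH]; first by rewrite mul0r; constructor.
rewrite mulrDl -pzscalerAl; apply: Ae_hpartP => // {IH}.
elim: hy => [|c' y1 y2 h2 _ IH]; first by rewrite mulr0; constructor.
rewrite mulrDr -pzscalerAr; apply: Ae_hpartP => //.
by apply: Ae_hpart_word; apply: Ae_wordM.
Qed.

Lemma Ae_hpart_m i a : homog A i a -> Ae_hpart i (m a).
Proof.
move=> ha; rewrite -[m a]mulr1 -[i]addr0; apply/Ae_hpart_word/word_m => //.
exact: word1.
Qed.

Lemma Ae_hpart_h i a : homog A i a -> Ae_hpart i (h a).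
Proof.
move=> ha; rewrite -[h a]mulr1 -[i]addr0; apply/Ae_hpart_word/word_h => //.
exact: word1.
Qed.

Let fsum x := exists (s : seq int) (f : int -> E),
  [/\ uniq s, forall i, Ae_hpart i (f i), forall i, i \notin s -> f i = 0
    & x = \sum_(i <- s) f i].

Let fsum_homog i x : Ae_hpart i x -> fsum x.
Proof.
move=> hx; exists [:: i], (fun j => if j == i then x else 0); split=> //.
- by move=> j; case: eqP => [->|_] //; constructor.
- by move=> j; rewrite inE => /negbTE ->.
- by rewrite big_seq1 eqxx.
Qed.

Let fsum0 : fsum 0.
Proof. by apply: (@fsum_homog 0); constructor. Qed.

Let fsumD x y : fsum x -> fsum y -> fsum (x + y).
Proof.
move=> [s [f [us hf f0 ->]]] [t [g [ut hg g0 ->]]].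
pose u := undup (s ++ t); have uu : uniq u by apply: undup_uniq.
have su : {subset s <= u} by move=> i; rewrite mem_undup mem_cat => ->.
have tu : {subset t <= u} by move=> i; rewrite mem_undup mem_cat orbC => ->.
exists u, (fun i => f i + g i); split=> //.
- by move=> i; apply: Ae_hpartD.
- move=> i; rewrite mem_undup mem_cat negb_or => /andP[/f0 -> /g0 ->].
  by rewrite addr0.
- by rewrite big_split /= (big_supp us uu su f0) (big_supp ut uu tu g0).
Qed.

Let fsumP x : fsum x.
Proof.
have fs (I : Type) (s : seq I) (F : I -> E) :
    (forall z, fsum (F z)) -> fsum (\sum_(z <- s) F z).
  by move=> hF; apply: big_ind.
elim/Ae_gen_ind: x => [a|a|||x y hx hy|c x|x y].
- rewrite (hprojE G a) (lin_sum Ae_m_linear); apply: (fs) => i.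
  apply: (@fsum_homog i); apply: Ae_hpart_m; exact: hprojP.
- rewrite (hprojE G a) (lin_sum Ae_h_linear); apply: (fs) => i.
  apply: (@fsum_homog i); apply: Ae_hpart_h; exact: hprojP.
- exact: fsum0.
- by apply: (@fsum_homog 0); apply/Ae_hpart_word/word1.
- exact: fsumD.
- move=> [s [f [_ hf _ ->]]]; rewrite scaler_sumr; apply: (fs) => i.
  by apply: (@fsum_homog i); apply: Ae_hpartZ.
- move=> [s [f [_ hf _ ->]]] [t [g [_ hg _ ->]]].
  rewrite mulr_suml; apply: (fs) => i; rewrite mulr_sumr; apply: (fs) => j.
  by apply: (@fsum_homog (i + j)); apply: Ae_hpartM.
Qed.

Fact Ae_hpart_span x : exists (s : seq int) (f : int -> E),
  (forall i, Ae_hpart i (f i)) /\ x = \sum_(i <- s) f i.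
Proof. by have [s [f [_ hf _ e]]] := fsumP x; exists s, f. Qed.

(* Independence of the components: each term acts on the
   functions [int -> E], an element of degree [i] acting by left multiplication
   followed by the shift by [i]. *)
Fixpoint Ae_rho (t : Ae_term A) : (int -> E) -> int -> E :=
  match t with
  | tM a => fun g n => hlift G (fun i ai => m ai * g (n - i)) a
  | tH a => fun g n => hlift G (fun i ai => h ai * g (n - i)) a
  | t0 => fun _ _ => 0
  | t1 => id
  | tadd s t => fun g n => Ae_rho s g n + Ae_rho t g n
  | tscale c s => fun g n => c *: Ae_rho s g n
  | tmul s t => fun g => Ae_rho s (Ae_rho t g)
  end.

Let rho_m_hl y i : linear (fun a => m a * y).
Proof. by move=> c a b; rewrite Ae_m_linear mulrDl -pzscalerAl. Qed.

Let rho_h_hl y i : linear (fun a => h a * y).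
Proof. by move=> c a b; rewrite Ae_h_linear mulrDl -pzscalerAl. Qed.

Lemma Ae_rho_m i a g n : homog A i a -> Ae_rho (tM a) g n = m a * g (n - i).
Proof. by move=> ha; rewrite /= (hlift_homog _ ha) // => j; apply: rho_m_hl. Qed.

Lemma Ae_rho_h i a g n : homog A i a -> Ae_rho (tH a) g n = h a * g (n - i).
Proof. by move=> ha; rewrite /= (hlift_homog _ ha) // => j; apply: rho_h_hl. Qed.

Lemma Ae_rhoD t f g :
  Ae_rho t (fun n => f n + g n) = (fun n => Ae_rho t f n + Ae_rho t g n).
Proof.
elim: t f g => //= [a|a||s IHs t IHt|c s IHs|s IHs t IHt] f g; apply/funext => n.
- by rewrite /hlift -big_split; apply: eq_bigr => i _; rewrite mulrDr.
- by rewrite /hlift -big_split; apply: eq_bigr => i _; rewrite mulrDr.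
- by rewrite addr0.
- by rewrite IHs IHt (AC (2*2) ((1*3)*(2*4))).
- by rewrite IHs scalerDr.
- by rewrite IHt IHs.
Qed.

Lemma Ae_rhoZ t c g : Ae_rho t (fun n => c *: g n) = (fun n => c *: Ae_rho t g n).
Proof.
elim: t g => //= [a|a||s IHs t IHt|c' s IHs|s IHs t IHt] g; apply/funext => n.
- by rewrite /hlift scaler_sumr; apply: eq_bigr => i _; rewrite pzscalerAr.
- by rewrite /hlift scaler_sumr; apply: eq_bigr => i _; rewrite pzscalerAr.
- by rewrite scaler0.
- by rewrite IHs IHt scalerDr.
- by rewrite IHs !scalerA mulrC.
- by rewrite IHt IHs.
Qed.

Lemma Ae_rho_eqv s t : Ae_eqv s t -> Ae_rho s = Ae_rho t.
Proof.
have lM f n i : linear (fun a => m a * f (n - i)) := rho_m_hl (f (n - i)) i.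
have lH f n i : linear (fun a => h a * f (n - i)) := rho_h_hl (f (n - i)) i.
have rM u v f n : Ae_rho (tmul u v) f n = Ae_rho u (Ae_rho v f) n by [].
have rD u v f n : Ae_rho (tadd u v) f n = Ae_rho u f n + Ae_rho v f n by [].
have rZ c u f n : Ae_rho (tscale c u) f n = c *: Ae_rho u f n by [].
elim=> {s t} //.
- by move=> s t u _ -> _ ->.
- by move=> s s' t t' _ es _ et /=; rewrite es et.
- by move=> c s s' _ es /=; rewrite es.
- by move=> s s' t t' _ es _ et /=; rewrite es et.
- by move=> s t u; apply/funext => f; apply/funext => n /=; rewrite addrA.
- by move=> s t; apply/funext => f; apply/funext => n /=; rewrite addrC.
- by move=> s; apply/funext => f; apply/funext => n /=; rewrite add0r.
- by move=> s; apply/funext => f; apply/funext => n /=; rewrite scaleN1r addNr.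
- by move=> c c' s; apply/funext => f; apply/funext => n /=; rewrite scalerA.
- by move=> s; apply/funext => f; apply/funext => n /=; rewrite scale1r.
- by move=> c s t; apply/funext => f; apply/funext => n /=; rewrite scalerDr.
- by move=> c c' s; apply/funext => f; apply/funext => n /=; rewrite scalerDl.
- by move=> s t u; apply/funext => f /=; rewrite Ae_rhoD.
- by move=> c s t; apply/funext => f /=; rewrite Ae_rhoZ.
- move=> c a b; apply/funext => f; apply/funext => n.
  exact: (hlift_linear G (lM f n)).
- move=> c a b; apply/funext => f; apply/funext => n.
  exact: (hlift_linear G (lH f n)).
- move=> i j a b ha hb; apply/funext => f; apply/funext => n.
  rewrite ?rD ?rZ ?rM (Ae_rho_m _ _ (dga_degM ha hb)) (Ae_rho_m _ _ ha) (Ae_rho_m _ _ hb).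
  by rewrite Ae_mM opprD addrA mulrA.
- move=> i j a b ha hb; apply/funext => f; apply/funext => n.
  rewrite ?rD ?rZ ?rM (Ae_rho_h _ _ (dga_degM ha hb)) (Ae_rho_m _ _ ha) (Ae_rho_m _ _ hb).
  rewrite ?rD ?rZ ?rM (Ae_rho_h _ _ ha) (Ae_rho_h _ _ hb).
  by rewrite (Ae_hM ha hb) mulrDl -pzscalerAl opprD -!mulrA addrA [n - i - j]addrAC.
- move=> i j a b ha hb; apply/funext => f; apply/funext => n.
  rewrite ?rD ?rZ ?rM (Ae_rho_m _ _ (dgl_deg (pbr_lie A) ha hb)).
  rewrite (Ae_rho_h _ _ ha) !(Ae_rho_m _ _ hb) (Ae_rho_h _ _ ha).
  rewrite (Ae_mbr ha hb) mulrBl -pzscalerAl opprD -!mulrA addrA scaleNr.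
  by rewrite [n - j - i]addrAC.
- move=> i j a b ha hb; apply/funext => f; apply/funext => n.
  rewrite ?rD ?rZ ?rM (Ae_rho_h _ _ (dgl_deg (pbr_lie A) ha hb)).
  rewrite (Ae_rho_h _ _ ha) !(Ae_rho_h _ _ hb) (Ae_rho_h _ _ ha).
  rewrite (Ae_hbr ha hb) mulrBl -pzscalerAl opprD -!mulrA addrA scaleNr.
  by rewrite [n - j - i]addrAC.
- apply/funext => f; apply/funext => n.
  by rewrite (Ae_rho_m _ _ (dga_deg1 A)) Ae_m1 mul1r subr0.
Qed.

Let Rho x := Ae_rho (Ae_repr x).

Let Rho_pi t : Rho (pi t) = Ae_rho t.
Proof. exact: Ae_rho_eqv (Ae_repr_eqv t). Qed.

Let RhoE :
  [/\ forall n f, Rho 0 f n = 0, forall f, Rho 1 f = f,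
      forall x y f n, Rho (x + y) f n = Rho x f n + Rho y f n,
      forall c x f n, Rho (c *: x) f n = c *: Rho x f n
    & forall x y f, Rho (x * y) f = Rho x (Rho y f)].
Proof.
split.
- by move=> n f; rewrite Ae_0 Rho_pi.
- by move=> f; rewrite Ae_1 Rho_pi.
- by elim/Ae_ind=> s; elim/Ae_ind=> t f n; rewrite Ae_D !Rho_pi.
- by move=> c; elim/Ae_ind=> s f n; rewrite Ae_Z !Rho_pi.
- by elim/Ae_ind=> s; elim/Ae_ind=> t f; rewrite Ae_M !Rho_pi.
Qed.

Let Rho_homog i x f n : Ae_hpart i x -> Rho x f n = x * f (n - i).
Proof.
have [R0 R1 RD RZ RM] := RhoE.
elim=> [|c x1 y1 hw _ IH]; first by rewrite R0 mul0r.
rewrite RD RZ IH mulrDl -pzscalerAl; congr (_ *: _ + _) => {IH}.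
elim: hw f n => [|i1 i2 a x2 ha _ IH|i1 i2 a x2 ha _ IH] f n.
- by rewrite R1 mul1r subr0.
- by rewrite RM Rho_pi (Ae_rho_m _ _ ha) IH opprD addrA mulrA.
- by rewrite RM Rho_pi (Ae_rho_h _ _ ha) IH opprD addrA mulrA.
Qed.

Fact Ae_hpart_free (s : seq int) (f : int -> E) : uniq s ->
  (forall i, Ae_hpart i (f i)) -> \sum_(i <- s) f i = 0 ->
  forall i, i \in s -> f i = 0.
Proof.
move=> us hf e0 i si; have [R0 R1 RD RZ RM] := RhoE.
pose dl (n : int) : E := if n == 0 then 1 else 0.
have <- : Rho (\sum_(i <- s) f i) dl i = 0 by rewrite e0 R0.
rewrite (big_morph (fun x => Rho x dl i) (fun x y => RD x y dl i) (R0 i dl)).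
rewrite (bigD1_seq i) //= (Rho_homog _ _ (hf i)) subrr mulr1.
rewrite big1 ?addr0 // => j ji.
by rewrite (Rho_homog _ _ (hf j)) /dl subr_eq0 eq_sym (negbTE ji) mulr0.
Qed.

Definition Ae_grading : grading E :=
  @Grading k E Ae_hpart Ae_hpart0 Ae_hpartP Ae_hpart_span Ae_hpart_free.

Lemma Ae_eps_homog i x : Ae_hpart i x -> Ae_eps x = (-1) ^ i *: x.
Proof.
elim=> [|c x1 y1 hw _ IH]; first by rewrite (lin0 Ae_eps_linear) scaler0.
rewrite Ae_eps_linear IH scalerDr; congr (_ + _).
rewrite scalerA mulrC -scalerA; congr (_ *: _) => {IH}.
elim: hw => [|i1 i2 a x2 ha _ IH|i1 i2 a x2 ha _ IH].
- by rewrite Ae_eps1 expr0z scale1r.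
- by rewrite Ae_epsM IH (Ae_eps_m ha) -pzscalerAl -pzscalerAr scalerA sgD.
- by rewrite Ae_epsM IH (Ae_eps_h ha) -pzscalerAl -pzscalerAr scalerA sgD.
Qed.

Fact Ae_d_deg i x : Ae_hpart i x -> Ae_hpart (i + 1) (Ae_d x).
Proof.
elim=> [|c x1 y1 hw _ IH]; first by rewrite linear0; constructor.
rewrite linearP /=; apply: Ae_hpartP => // {IH}.
have e (p q : int) : p + q + 1 = p + 1 + q by rewrite addrAC.
elim: hw => [|i1 i2 a x2 ha hx IH|i1 i2 a x2 ha hx IH].
- by rewrite Ae_d1; constructor.
- rewrite Ae_dM Ae_d_m (Ae_eps_m ha) -pzscalerAl; apply: Ae_hpartD.
    rewrite e; apply: Ae_hpartM; last exact: Ae_hpart_word.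
    by apply: Ae_hpart_m; apply: dgd_deg.
  by apply: Ae_hpartZ; rewrite -addrA; apply: Ae_hpartM => //; apply: Ae_hpart_m.
- rewrite Ae_dM Ae_d_h (Ae_eps_h ha) -pzscalerAl; apply: Ae_hpartD.
    rewrite e; apply: Ae_hpartM; last exact: Ae_hpart_word.
    by apply: Ae_hpart_h; apply: dgd_deg.
  by apply: Ae_hpartZ; rewrite -addrA; apply: Ae_hpartM => //; apply: Ae_hpart_h.
Qed.

Fact Ae_dd x : Ae_d (Ae_d x) = 0.
Proof.
have [s [f [hf ->]]] := Ae_hpart_span x.
rewrite !linear_sum big1 // => i _ /=.
elim: (hf i) => [|c x1 y1 hw _ IH]; first by rewrite !linear0.
rewrite !linearP /= IH addr0 -[RHS](scaler0 _ c); congr (_ *: _) => {IH}.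
elim: hw => [|i1 i2 a x2 ha hx IH|i1 i2 a x2 ha hx IH].
- by rewrite Ae_d1 linear0.
- rewrite Ae_dM Ae_d_m (Ae_eps_m ha) -pzscalerAl linearD linearZ /= !Ae_dM !Ae_d_m.
  rewrite IH mulr0 addr0 (Ae_eps_m (dgd_deg ha)).
  rewrite [dgd A (dgd A a)]dgv_dd (lin0 Ae_m_linear) mul0r add0r -pzscalerAl.
  by rewrite sgD mulrN1 scaleNr addNr.
- rewrite Ae_dM Ae_d_h (Ae_eps_h ha) -pzscalerAl linearD linearZ /= !Ae_dM !Ae_d_h.
  rewrite IH mulr0 addr0 (Ae_eps_h (dgd_deg ha)).
  rewrite [dgd A (dgd A a)]dgv_dd (lin0 Ae_h_linear) mul0r add0r -pzscalerAl.
  by rewrite sgD mulrN1 scaleNr addNr.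
Qed.

Fact Ae_d_leibniz i x y : Ae_hpart i x ->
  Ae_d (x * y) = Ae_d x * y + (-1) ^ i *: (x * Ae_d y).
Proof. by move=> hx; rewrite Ae_dM (Ae_eps_homog hx) -pzscalerAl. Qed.

Fact Ae_deg1 : Ae_hpart 0 1.
Proof. exact/Ae_hpart_word/word1. Qed.

Definition Ae : dgAlg k :=
  @DGAlg k E Ae_grading Ae_d Ae_d_deg Ae_dd Ae_deg1 Ae_hpartM Ae_d_leibniz.

End AeTheory.

Section Envelope.
Variables (k : fieldType) (A : dgPoisson k).

Definition enveloping_pair (D : dgAlg k) (f g : A -> D) : Prop :=
  [/\ @is_dgAlgHom k A D f,
      @is_dgLieHom k (dgLie_of_dgPoisson A) (dgLie_of_dgAlg D) g,
      forall i j (a b : A), homog A i a -> homog A j b ->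
        f (pbr a b) = g a * f b - (-1) ^ (i * j) *: (f b * g a)
    & forall i j (a b : A), homog A i a -> homog A j b ->
        g (a * b) = f a * g b + (-1) ^ (i * j) *: (f b * g a)].

Definition is_universal_envelope (U : dgAlg k) (m h : A -> U) : Prop :=
  enveloping_pair m h /\
  forall (D : dgAlg k) (f g : A -> D), enveloping_pair f g ->
    exists! phi : U -> D,
      [/\ is_dgAlgHom phi, phi \o m = f & phi \o h = g].

End Envelope.

(* Main.v *)
(* A left action of [Ae A] on a complex amounts to two actions of [A], by [m] and
   by [h], and the defining relations of [Ae A] are word for word the axioms of a
   Poisson module: restricting along [m] and [h] is a functor to Poisson modules,
   evaluating the terms in the [m_a] and [h_a] is its inverse.  Universality is the
   same evaluation with values in the algebra [D].  In both cases degrees and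
   differentials need only be checked on the generators. *)

Require Import Defs.
From mathcomp Require Import all_boot all_order all_algebra.
From mathcomp Require Import boolp.

Set Implicit Arguments.
Unset Strict Implicit.
Unset Printing Implicit Defensive.

Import GRing.Theory.
Local Open Scope ring_scope.

(** * Equality of functors and of DG modules through transport *)

Definition ecastT (T U : Type) (e : T = U) (x : T) : U :=
  let: erefl := e in x.

(* [fhom F f = f] is ill-typed, as [F X] and [X] are only propositionally equal;
   comparing underlying maps helps because the carriers of the modules [F X] and
   [X] below are convertible, so that [eU] can be taken to be [erefl]. *)
Lemma functor_eq_id (C : category) (U : C -> Type)
    (u : forall X Y, chom X Y -> U X -> U Y) (F : functor C C)
    (eU : forall X, U (F X) = U X) :
  (forall X Y (f g : chom X Y), u X Y f =1 u X Y g -> f = g) ->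
  (forall X, F X = X) ->
  (forall X Y (f : chom X Y) x,
     ecastT (eU Y) (u _ _ (fhom F f) x) = u _ _ f (ecastT (eU X) x)) ->
  F = functor_id C.
Proof.
move=> u_inj; case: F eU => Fo Fh Fh1 FhM /= eU /funext eF.
have {}eF : id = Fo by rewrite eF.
case: _ / eF in Fh Fh1 FhM eU * => /= hu.
have {hu} eFh : (fun _ _ => id) = Fh.
  apply: functional_extensionality_dep => X; apply: functional_extensionality_dep => Y.
  apply/funext => f; apply: u_inj => x.
  (* The functor is now the identity on objects, so each [eU X] equates a type with itself and its
     cast is trivial. *)
  by have := hu X Y f x; rewrite !(Prop_irrelevance (eU _) erefl).
case: _ / eFh in Fh1 FhM *; rewrite /functor_id.
by rewrite (Prop_irrelevance Fh1 (fun=> erefl))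
           (Prop_irrelevance FhM (fun _ _ _ _ _ => erefl)).
Qed.

Section ModuleEq.
Variable k : fieldType.

Definition ecastV (V W : dgVect k) (e : V = W) (x : V) : W :=
  let: erefl := e in x.

(** The complex and the action are the only data of a DG module; the remaining fields are proofs,
    equal by irrelevance. *)
Lemma dgMod_eq (R : dgAlg k) (M N : dgMod R) (e : dgm_vect M = dgm_vect N) :
  (forall r x, ecastV e (act r x) = act r (ecastV e x)) -> M = N.
Proof.
case: M N e => [V a p1 p2 p3 p4 p5] [W b q1 q2 q3 q4 q5] /= e.
case: _ / e in b q1 q2 q3 q4 q5 * => /= eab.
have {}eab : a = b by apply/funext => r; apply/funext.
by case: _ / eab in q1 q2 q3 q4 q5 *; congr DGMod; exact: Prop_irrelevance.
Qed.

Lemma dgPMod_eq (A : dgPoisson k) (M N : dgPMod A) (e : dgm_vect M = dgm_vect N) :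
  (forall a x, ecastV e (act a x) = act a (ecastV e x)) ->
  (forall a x, ecastV e (pact a x) = pact a (ecastV e x)) -> M = N.
Proof.
move=> eact; have eM := dgMod_eq eact; move: eact.
case: M N e eM => [M a p1 p2 p3 p4 p5 p6] [N b q1 q2 q3 q4 q5 q6] /= e eM.
case: _ / eM in b q1 q2 q3 q4 q5 q6 e * => _.
(* [e] now equates a complex with itself, so its casts vanish. *)
rewrite (Prop_irrelevance e erefl) /= => eab.
have {}eab : a = b by apply/funext => r; apply/funext.
by case: _ / eab in q1 q2 q3 q4 q5 q6 *; congr DGPMod; exact: Prop_irrelevance.
Qed.

End ModuleEq.

(** * The generators of [Ae A] and its homogeneous elements *)

Section Envelope.
Variables (k : fieldType) (A : dgPoisson k).
Notation E := (Ae A).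
Notation m := (@Ae_m k A : A -> E).
Notation h := (@Ae_h k A : A -> E).

(** Homogeneous elements are combinations of words, and a word is [1] or a homogeneous generator
    times a shorter word. The product case records the degree of the left factor, whose sign enters
    the Leibniz rule. *)
Lemma Ae_homog_ind (P : int -> E -> Prop) :
  (forall n, P n 0) ->
  (forall n c x y, P n x -> P n y -> P n (c *: x + y)) ->
  P 0 1 ->
  (forall i a, homog A i a -> P i (m a)) ->
  (forall i a, homog A i a -> P i (h a)) ->
  (forall i j x y, homog E i x -> P i x -> P j y -> P (i + j) (x * y)) ->
  forall n x, homog E n x -> P n x.
Proof.
move=> P0 PL P1 Pm Ph PM n x; elim=> [|c x1 y1 hw _ IH]; first exact: P0.
apply: PL => // {IH}; elim: hw => [|i j a x2 ha _ IH|i j a x2 ha _ IH] //.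
- by apply: PM (Pm _ _ ha) IH => //; apply: Ae_hpart_m.
- by apply: PM (Ph _ _ ha) IH => //; apply: Ae_hpart_h.
Qed.

Lemma Ae_m_dg : is_dgAlgHom m.
Proof.
split; [split | exact: Ae_m1 | exact: Ae_mM].
- exact: Ae_m_linear.
- exact: Ae_hpart_m.
- by move=> a; rewrite /dgd /= Ae_d_m.
Qed.

Lemma Ae_h_dg : @dg_linear k A E h.
Proof.
split; [exact: Ae_h_linear | exact: Ae_hpart_h |].
by move=> a; rewrite /dgd /= Ae_d_h.
Qed.

(** Both brackets are bilinear, so it is enough to compare on homogeneous elements, where [gcomm] is
    the signed commutator. *)
Lemma dgLieHom_homog (D : dgAlg k) (g : A -> D) : @dg_linear k A D g ->
  (forall i j a b, homog A i a -> homog A j b ->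
    g (pbr a b) = g a * g b - (-1) ^ (i * j) *: (g b * g a)) ->
  @is_dgLieHom k (dgLie_of_dgPoisson A) (dgLie_of_dgAlg D) g.
Proof.
move=> gdg gbr; have [gl ghom _] := gdg; split=> //= a b.
have [brl brr] := dgl_bilin (pbr_lie A); have [cl cr] := @gcomm_bilin k D.
have ext (u v : A -> D) := @homog_ext k A (dga_gr A) D u v.
move: a; refine (ext (fun a => _) (fun a => _) _ _ _) => [c x y|c x y|i a ha].
- by rewrite brr gl.
- by rewrite gl cr.
move: b; refine (ext (fun b => _) (fun b => _) _ _ _) => [c x y|c x y|j b hb].
- by rewrite brl gl.
- by rewrite gl cl.
by rewrite (gbr i j) // (gcommE (ghom _ _ ha) (ghom _ _ hb)).
Qed.

Lemma Ae_enveloping_pair : @enveloping_pair k A E m h.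
Proof.
split; [exact: Ae_m_dg | | exact: Ae_mbr | exact: Ae_hM].
apply: dgLieHom_homog; [exact: Ae_h_dg | exact: Ae_hbr].
Qed.

(** * The universal property *)

Section Lift.
Variables (D : dgAlg k) (f g : A -> D).
Hypothesis fg : enveloping_pair f g.

Definition Ae_lift (x : E) : D := Ae_eval f g (Ae_repr x).

(** An enveloping pair satisfies the defining relations in [D], so evaluation does not depend on the
    representative. *)
Lemma Ae_lift_pi t : Ae_lift (Ae_pi t) = Ae_eval f g t.
Proof.
have [[[fl _ _] f1 fM] [[gl ghom _] gbr] fbr gM] := fg.
apply: (Ae_eval_eqv fl gl f1 _ gM fbr _ (Ae_repr_eqv t)) => // i j a b ha hb.
(* The Lie condition on [g] is stated with [gcomm]; as [g] preserves degrees, it becomes the signed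
   formula. *)
by rewrite [LHS]gbr /= (gcommE (ghom _ _ ha) (ghom _ _ hb)).
Qed.

Lemma Ae_lift_m a : Ae_lift (m a) = f a.
Proof. exact: Ae_lift_pi. Qed.

Lemma Ae_lift_h a : Ae_lift (h a) = g a.
Proof. exact: Ae_lift_pi. Qed.

Lemma Ae_lift1 : Ae_lift 1 = 1.
Proof. by rewrite Ae_1 Ae_lift_pi. Qed.

Lemma Ae_lift_linear : linear Ae_lift.
Proof.
move=> c; elim/Ae_ind=> s; elim/Ae_ind=> t.
by rewrite Ae_Z Ae_D !Ae_lift_pi.
Qed.

Lemma Ae_liftM x y : Ae_lift (x * y) = Ae_lift x * Ae_lift y.
Proof. by elim/Ae_ind: x => s; elim/Ae_ind: y => t; rewrite Ae_M !Ae_lift_pi. Qed.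

(** The two claims go together: on a product, the Leibniz rule in [D] needs the degree of the image
    of the left factor. *)
Lemma Ae_lift_homog n x : homog E n x ->
  homog D n (Ae_lift x) /\ Ae_lift (dgd E x) = dgd D (Ae_lift x).
Proof.
have [[[_ fhom fd] _ _] [[_ ghom gd] _] _ _] := fg.
have L0 := lin0 Ae_lift_linear; have [dL dL0] := (@dgd_linear k, lin0 (@dgd_linear k D)).
elim/Ae_homog_ind: n x / => [n|n c x y [hx dx] [hy dy]||i a ha|i a ha|i j x y Hx [hx dx] [hy dy]].
- by rewrite (lin0 (dL E)) L0 dL0; split=> //; apply: hpart0.
- by rewrite dL !Ae_lift_linear dL dx dy; split=> //; apply: hpartP.
- by rewrite dga_d1 L0 Ae_lift1 dga_d1; split=> //; apply: dga_deg1.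
- by rewrite [dgd E _]Ae_d_m !Ae_lift_m; split; [apply: fhom | apply: fd].
- by rewrite [dgd E _]Ae_d_h !Ae_lift_h; split; [apply: ghom | apply: gd].
rewrite Ae_liftM (dgd_mul _ Hx) (dgd_mul _ hx) -dx -dy; split; first exact: dga_degM.
by rewrite (linD Ae_lift_linear) (linZ Ae_lift_linear) !Ae_liftM.
Qed.

Lemma Ae_lift_dg : is_dgAlgHom Ae_lift.
Proof.
split; [split | exact: Ae_lift1 | exact: Ae_liftM].
- exact: Ae_lift_linear.
- by move=> i x /Ae_lift_homog[].
have dL := @dgd_linear k; have lL := Ae_lift_linear.
refine (@homog_ext k E (dga_gr E) D (fun x => _) (fun x => _) _ _ _) => [c x y|c x y|i x /Ae_lift_homog[]] //.
- by rewrite dL lL.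
- by rewrite lL dL.
Qed.

End Lift.

(** Gives uniqueness: the [m_a] and [h_a] generate [Ae A] as an algebra. *)
Lemma Ae_hom_ext (D : dgAlg k) (phi psi : E -> D) :
  is_dgAlgHom phi -> is_dgAlgHom psi ->
  phi \o m = psi \o m -> phi \o h = psi \o h -> phi = psi.
Proof.
move=> [[pl _ _] p1 pM] [[ql _ _] q1 qM] em eh; apply/funext.
elim/Ae_gen_ind=> [a|a|||x y ex ey|c x ex|x y ex ey].
- exact: (congr1 (fun u => u a) em).
- exact: (congr1 (fun u => u a) eh).
- by rewrite (lin0 pl) (lin0 ql).
- by rewrite p1 q1.
- by rewrite (linD pl) (linD ql) ex ey.
- by rewrite (linZ pl) (linZ ql) ex.
- by rewrite pM qM ex ey.
Qed.

Lemma Ae_universal : @is_universal_envelope k A E m h.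
Proof.
split=> [|D f g fg]; first exact: Ae_enveloping_pair.
exists (Ae_lift f g); split=> [|psi [psidg em eh]].
  split; first exact: Ae_lift_dg.
  - by apply/funext => a; apply: Ae_lift_m.
  - by apply/funext => a; apply: Ae_lift_h.
apply: Ae_hom_ext => //; first exact: Ae_lift_dg.
- by rewrite em; apply/funext => a; apply: Ae_lift_m.
- by rewrite eh; apply/funext => a; apply: Ae_lift_h.
Qed.

(** * From Poisson modules to modules over [Ae A] *)

Section Extension.
Variable M : dgPMod A.

(** Parallels [Ae_eval] with composition as product; kept separate because arbitrary self-maps of
    [M] do not form an algebra. *)
Fixpoint term_act (t : Ae_term A) : M -> M :=
  match t with
  | tM a => act a
  | tH a => pact a
  | t0 => fun=> 0
  | t1 => id
  | tadd s t => fun x => term_act s x + term_act t x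
  | tscale c s => fun x => c *: term_act s x
  | tmul s t => fun x => term_act s (term_act t x)
  end.

(** Needed for the relations [s (t + u) = s t + s u] and [c (s t) = s (c t)], which may fail for
    composition of non-linear maps. *)
Lemma term_act_linear t : linear (term_act t).
Proof.
elim: t => [a|a|||s IHs t IHt|c' s IHs|s IHs t IHt] c x y //=.
- by rewrite (act_bilin M).1.
- by rewrite (pact_bilin M).1.
- by rewrite scaler0 addr0.
- by rewrite IHs IHt scalerDr (AC (2*2) ((1*3)*(2*4))).
- by rewrite IHs scalerDr !scalerA mulrC.
- by rewrite IHt IHs.
Qed.

Lemma term_act_eqv s t : Ae_eqv s t -> term_act s =1 term_act t.
Proof.
have [aL pL] := ((act_bilin M).2, (pact_bilin M).2).
elim=> {s t} //=.
- by move=> s t _ est x; rewrite est.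
- by move=> s t u _ est _ etu x; rewrite est etu.
- by move=> s s' t t' _ es _ et x; rewrite es et.
- by move=> c s s' _ es x; rewrite es.
- by move=> s s' t t' _ es _ et x; rewrite es et.
- by move=> s t u x; rewrite addrA.
- by move=> s t x; rewrite addrC.
- by move=> s x; rewrite add0r.
- by move=> s x; rewrite scaleN1r addNr.
- by move=> c c' s x; rewrite scalerA.
- by move=> s x; rewrite scale1r.
- by move=> c s t x; rewrite scalerDr.
- by move=> c c' s x; rewrite scalerDl.
- by move=> s t u x; rewrite (linD (term_act_linear s)).
- by move=> c s t x; rewrite (linZ (term_act_linear s)).
- by move=> c a b x; rewrite aL.
- by move=> c a b x; rewrite pL.
- by move=> i j a b _ _ x; rewrite actM.
- by move=> i j a b ha hb x; rewrite (pactM _ ha hb).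
(* The bracket relations are the module axioms with the signed term moved to the other side. *)
- by move=> i j a b ha hb x; rewrite (pact_act _ ha hb) scaleNr addrK.
- by move=> i j a b ha hb x; rewrite (pact_br _ ha hb) scaleNr addrK.
- by move=> x; rewrite act1.
Qed.

Definition Ae_act (r : E) : M -> M := term_act (Ae_repr r).

Lemma Ae_act_pi t x : Ae_act (Ae_pi t) x = term_act t x.
Proof. exact: term_act_eqv (Ae_repr_eqv t) x. Qed.

Lemma Ae_act_m a x : Ae_act (m a) x = act a x.
Proof. exact: Ae_act_pi. Qed.

Lemma Ae_act_h a x : Ae_act (h a) x = pact a x.
Proof. exact: Ae_act_pi. Qed.

Lemma Ae_act_bilin : bilin Ae_act.
Proof.
split=> [r|x]; first exact: term_act_linear.
by move=> c; elim/Ae_ind=> s; elim/Ae_ind=> t; rewrite Ae_Z Ae_D !Ae_act_pi.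
Qed.

Lemma Ae_act1 x : Ae_act 1 x = x.
Proof. by rewrite Ae_1 Ae_act_pi. Qed.

Lemma Ae_actM r s x : Ae_act (r * s) x = Ae_act r (Ae_act s x).
Proof. by elim/Ae_ind: r => r; elim/Ae_ind: s => s; rewrite Ae_M !Ae_act_pi. Qed.

Lemma Ae_act_deg i j r x :
  homog E i r -> homog M j x -> homog M (i + j) (Ae_act r x).
Proof.
have [_ aL] := Ae_act_bilin.
(* For a product [r * s] the hypothesis on [r] is applied to the image of [x] under [s], so [j] and
   [x] must stay general. *)
move=> hr; move: j x.
elim/Ae_homog_ind: i r / hr => [n|n c r s hr hs||i a ha|i a ha|i i' r s _ hr hs] j x hx.
- by rewrite (lin0 (aL x)); apply: hpart0.
- by rewrite aL; apply: hpartP; [apply: hr | apply: hs].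
- by rewrite add0r Ae_act1.
- by rewrite Ae_act_m; apply: act_deg.
- by rewrite Ae_act_h; apply: pact_deg.
- by rewrite Ae_actM -addrA; apply/hr/hs.
Qed.

Lemma Ae_act_d i r x : homog E i r ->
  dgd M (Ae_act r x) = Ae_act (dgd E r) x + (-1) ^ i *: Ae_act r (dgd M x).
Proof.
have [aR aL] := Ae_act_bilin; have dL := @dgd_linear k.
move=> hr; move: x.
elim/Ae_homog_ind: i r / hr => [n|n c r s dr ds||i a ha|i a ha|i j r s hr dr ds] x.
- by rewrite (lin0 (dL E)) !(lin0 (aL _)) (lin0 (dL M)) scaler0 addr0.
- rewrite dL !aL dL dr ds !scalerDr !scalerA [c * _]mulrC.
  by rewrite (AC (2*2) ((1*3)*(2*4))).
- by rewrite dga_d1 (lin0 (aL x)) !Ae_act1 expr0z scale1r add0r.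
- by rewrite [dgd E _]Ae_d_m !Ae_act_m (act_d _ ha).
- by rewrite [dgd E _]Ae_d_h !Ae_act_h (pact_d _ ha).
- rewrite (dgd_mul _ hr) (linD (aL x)) (linZ (aL x)) !Ae_actM dr ds.
  by rewrite (linD (aR r)) (linZ (aR r)) scalerDr scalerA -sgD addrA.
Qed.

Definition dgMod_of_dgPMod : dgMod E :=
  DGMod Ae_act_bilin Ae_act1 Ae_actM Ae_act_deg Ae_act_d.

End Extension.

Lemma dgPModHom_Ae_act (M N : dgPMod A) (f : dgPModHom M N) (r : E) x :
  f (Ae_act r x) = Ae_act r (f x).
Proof.
have [[[fl _ _] fa] fp] := (dgmh_dg f, dgmh_act f, dgpmh_pact f).
elim/Ae_ind: r => t; rewrite !Ae_act_pi.
elim: t x => [a|a|||s IHs t IHt|c s IHs|s IHs t IHt] x //=.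
- exact: lin0.
- by rewrite (linD fl) IHs IHt.
- by rewrite (linZ fl) IHs.
- by rewrite IHs IHt.
Qed.

Definition dgModHom_of_dgPModHom (M N : dgPMod A) (f : dgPModHom M N) :
    dgModHom (dgMod_of_dgPMod M) (dgMod_of_dgPMod N) :=
  @DGModHom k E (dgMod_of_dgPMod M) (dgMod_of_dgPMod N) f (dgmh_dg f)
    (dgPModHom_Ae_act f).

Definition ext_functor : functor (DGPMod_cat A) (DGMod_cat E).
Proof.
by refine (@Functor (DGPMod_cat A) (DGMod_cat E) dgMod_of_dgPMod
  dgModHom_of_dgPModHom _ _) => *; apply: dgModHom_eq.
Defined.

(** * From modules over [Ae A] back to Poisson modules *)

Section Restriction.
Variable N : dgMod E.
Let aR := (act_bilin N).1.
Let aL := (act_bilin N).2.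

(** Transparent, because the later casts along [erefl] need the underlying complex to reduce to that
    of [N]. *)
Definition restr_mod : dgMod A.
Proof.
refine (@DGMod k A N (fun a => act (m a)) _ _ _ _ _).
- split=> [a|x]; first exact: aR.
  by move=> c a b; rewrite Ae_m_linear aL.
- by move=> x; rewrite Ae_m1 act1.
- by move=> a b x; rewrite Ae_mM actM.
- by move=> i j a x ha; apply: act_deg; apply: Ae_hpart_m.
- by move=> i a x ha; rewrite -Ae_d_m; apply: act_d; apply: Ae_hpart_m.
Defined.

(** Passes from the relations of [Ae A], where a bracket is a signed commutator, to the module
    axioms, which are solved for the first product. *)
Let act_swap (z r s : E) i (x : N) :
  z = r - (-1) ^ i *: s -> act r x = act z x + (-1) ^ i *: act s x.
Proof. by move->; rewrite (linD (aL x)) -scaleNr (linZ (aL x)) scaleNr subrK. Qed.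

Definition dgPMod_of_dgMod : dgPMod A.
Proof.
refine (@DGPMod k A restr_mod (fun a => act (h a)) _ _ _ _ _ _).
- split=> [a|x]; first exact: aR.
  by move=> c a b; rewrite Ae_h_linear aL.
- by move=> i j a x ha; apply: (@act_deg k E N); apply: Ae_hpart_h.
- by move=> i j a b x ha hb; rewrite /= -!actM; apply/act_swap/Ae_mbr.
- move=> i j a b x ha hb; rewrite /= -!actM (Ae_hM ha hb).
  by rewrite (linD (aL x)) (linZ (aL x)).
- by move=> i j a b x ha hb; rewrite /= -!actM; apply/act_swap/Ae_hbr.
- by move=> i a x ha; rewrite -Ae_d_h; apply: (@act_d k E N); apply: Ae_hpart_h.
Defined.

End Restriction.

Definition dgPModHom_of_dgModHom (M N : dgMod E) (f : dgModHom M N) :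
    dgPModHom (dgPMod_of_dgMod M) (dgPMod_of_dgMod N) :=
  @DGPModHom k A (dgPMod_of_dgMod M) (dgPMod_of_dgMod N)
    (@DGModHom k A (restr_mod M) (restr_mod N) f (dgmh_dg f)
       (fun a => dgmh_act f (m a)))
    (fun a => dgmh_act f (h a)).

Definition restr_functor : functor (DGMod_cat E) (DGPMod_cat A).
Proof.
by refine (@Functor (DGMod_cat E) (DGPMod_cat A) dgPMod_of_dgMod
  dgPModHom_of_dgModHom _ _) => *; apply: dgPModHom_eq.
Defined.

(** * The two constructions are mutually inverse *)

Lemma restr_extK (M : dgPMod A) : dgPMod_of_dgMod (dgMod_of_dgPMod M) = M.
Proof.
(* Neither construction changes the complex, so [erefl] serves and the casts reduce away. *)
apply: (@dgPMod_eq k A (dgPMod_of_dgMod (dgMod_of_dgPMod M)) M erefl) => a x /=.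
  exact: Ae_act_m.
exact: Ae_act_h.
Qed.

(** Both actions are linear and multiplicative in the algebra argument and agree on the
    generators. *)
Lemma ext_restrK (N : dgMod E) : dgMod_of_dgPMod (dgPMod_of_dgMod N) = N.
Proof.
have aL := (act_bilin N).2.
apply: (@dgMod_eq k E (dgMod_of_dgPMod (dgPMod_of_dgMod N)) N erefl) => r x /=.
elim/Ae_gen_ind: r x => [a|a|||r s er es|c r er|r s er es] x.
- exact: (@Ae_act_m (dgPMod_of_dgMod N)).
- exact: (@Ae_act_h (dgPMod_of_dgMod N)).
- by rewrite (lin0 (aL x)) (lin0 ((Ae_act_bilin _).2 x)).
- by rewrite Ae_act1 act1.
- by rewrite (linD (aL x)) (linD ((Ae_act_bilin _).2 x)) er es.
- by rewrite (linZ (aL x)) (linZ ((Ae_act_bilin _).2 x)) er.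
- by rewrite Ae_actM actM es er.
Qed.

Lemma DGPMod_DGMod_isomorphic :
  isomorphic_categories (DGPMod_cat A) (DGMod_cat E).
Proof.
exists ext_functor, restr_functor; split.
(* Both functors keep the underlying maps, so the condition on morphisms holds by computation. *)
- apply: (@functor_eq_id (DGPMod_cat A) (fun M : dgPMod A => M : Type)
    (fun M N (f : dgPModHom M N) => f : M -> N)
    (functor_comp restr_functor ext_functor) (fun=> erefl)) => //.
  + by move=> M N f g; apply: dgPModHom_eq.
  + exact: restr_extK.
- apply: (@functor_eq_id (DGMod_cat E) (fun M : dgMod E => M : Type)
    (fun M N (f : dgModHom M N) => f : M -> N)
    (functor_comp ext_functor restr_functor) (fun=> erefl)) => //.
  + by move=> M N f g; apply: dgModHom_eq.
  + exact: ext_restrK.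
Qed.

End Envelope.

Theorem theoremB (k : fieldType) (A : dgPoisson k) :
  isomorphic_categories (DGPMod_cat A) (DGMod_cat (Ae A)) /\
  @is_universal_envelope k A (Ae A) (@Ae_m k A) (@Ae_h k A).
Proof. by split; [exact: DGPMod_DGMod_isomorphic | exact: Ae_universal]. Qed.
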